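(* Let $a,c$ be nonzero complex numbers and let $\ell,m,n$ be nonnegative integers. Then $$ {}_4\phi_3\left[\begin{matrix}a,\,q^{1+\ell}/a,\,q^{-n},\,-q^{-m-n}\\ c,\,q^{1+\ell-m-2n}/c,\,-q\end{matrix};q,q\right] =\frac{(q^{2}/(ac),\,-q/a;q)_\ell}{(q^{2}/a^2,\,-q/c;q)_\ell}\, \frac{(q^{1+m+n},\,-q^{-\ell}c;q)_n}{(q^{n+m-\ell}c,\,-q;q)_n}\sum_{i=0}^{\ell}\sum_{j=0}^{m}T_{i,j}, $$ where $$ T_{i,j}=q^{(\ell+1)i-nj+\binom{j+1}{2}}\,\frac{(-1)^{i+j}}{c^i}\,\frac{1-q^{1+2i}/a^2}{1-q/a^2}\, \frac{(q^{-\ell},\,c/a,\,q/a^2;q)_i}{(q,\,q^2/(ac),\,q^{2+\ell}/a^2;q)_i} $$ $$ \times\frac{(q^{-m},\,q^{-m-n},\,-q^{-m-n},\,q^{-i-1}ac,\,q^{i}c/a;q)_j}{(q,\,c,\,-c,\,q^{-m-2n},\,q^{j-2m-2n-1};q)_j}\, \frac{(q^{j-i}ac,\,q^{1+i+j}c/a;q^2)_{m+n-j}}{(q,\,q^{2j}c^2;q^2)_{m+n-j}}. $$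
   Context: $q$ is a nonzero complex number. For complex $x$ and an integer $n\ge 0$, the $q$-shifted factorial is $(x;q)_0=1$, $(x;q)_n=\prod_{k=0}^{n-1}(1-xq^k)$, and $(x_1,\dots,x_r;q)_n=\prod_{s=1}^r (x_s;q)_n$ (likewise with base $q^2$ in place of $q$). The basic hypergeometric series is ${}_4\phi_3\left[\begin{matrix}a_0,a_1,a_2,a_3\\ b_1,b_2,b_3\end{matrix};q,z\right]=\sum_{k\ge0}\frac{(a_0,a_1,a_2,a_3;q)_k}{(q,b_1,b_2,b_3;q)_k}z^k$. Here one upper parameter is $q^{-n}$, so the series terminates and means the sum over $0\le k\le n$. Parameters are assumed to be such that no zero factor appears in a denominator of the displayed expressions. *)

(* Defs.v *)
From mathcomp Require Import all_boot all_order all_algebra.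
From mathcomp Require Import reals.
From mathcomp Require Import complex.

Set Implicit Arguments.
Unset Strict Implicit.
Unset Printing Implicit Defensive.

Import GRing.Theory.
Local Open Scope ring_scope.

Section QSeries.
Variable F : fieldType.

(* (x; q)_n *)
Definition qpoch (x q : F) (n : nat) : F := \prod_(k < n) (1 - x * q ^+ k).

(* (x_1, ..., x_r; q)_n *)
Definition qpochs (xs : seq F) (q : F) (n : nat) : F :=
  \prod_(x <- xs) qpoch x q n.

(* The terminating series _{r+1}phi_r, where r+1 = size us and r = size bs.
   The series is summed over 0 <= k <= n; it is meant to be used when q^{-n}
   is one of the upper parameters us. *)
Definition qhyper (n : nat) (us bs : seq F) (q z : F) : F :=
  \sum_(k < n.+1) qpochs us q k / qpochs (q :: bs) q k * z ^+ k.

(* Integer exponents are exprz, i.e. q ^ (-n) = (q ^+ n)^-1. The natural number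
   subtraction m + n - j is only used for j <= m. *)
Definition Tterm (q a c : F) (l m n i j : nat) : F :=
  q ^ ((l%:Z + 1) * i%:Z - n%:Z * j%:Z + 'C(j.+1, 2)%:Z)
  * ((-1) ^+ (i + j) / c ^+ i)
  * ((1 - q ^+ (1 + 2 * i) / a ^+ 2) / (1 - q / a ^+ 2))
  * (qpochs [:: q ^ (- l%:Z); c / a; q / a ^+ 2] q i
     / qpochs [:: q; q ^+ 2 / (a * c); q ^+ (2 + l) / a ^+ 2] q i)
  * (qpochs [:: q ^ (- m%:Z); q ^ (- m%:Z - n%:Z); - q ^ (- m%:Z - n%:Z);
                q ^ (- i%:Z - 1) * a * c; q ^+ i * c / a] q j
     / qpochs [:: q; c; - c; q ^ (- m%:Z - 2 * n%:Z);
                  q ^ (j%:Z - 2 * m%:Z - 2 * n%:Z - 1)] q j)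
  * (qpochs [:: q ^ (j%:Z - i%:Z) * a * c; q ^+ (1 + i + j) * c / a]
       (q ^+ 2) (m + n - j)
     / qpochs [:: q; q ^+ (2 * j) * c ^+ 2] (q ^+ 2) (m + n - j)).

End QSeries.

(* Main.v *)
(** Sears' transformation turns the left-hand side into a series in which the
    pair [a, q^(1+l)/a] has become [-q/a, -a q^(-l)], and a very-well-poised
    summation expands that pair termwise into the pairs
    [-q^(1+i)/a, -a q^(-i)], from which the parameter [l] is gone: this is the
    sum over [i].  After a second Sears transformation, the same
    very-well-poised summation replaces [q^(-n), -q^(-m-n)] by the symmetric
    pairs [q^(-N), -q^(-N)] with [N = m + n - j]: this is the sum over [j].
    The remaining series are summed by Andrews' terminating q-Whipple formula.

    The hypotheses do not prevent zero denominators in the intermediate series,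
    so every 4phi3 is multiplied by the shifted factorials of its lower
    parameters, and its transformations are proved in that polynomial form. *)

Require Import Defs.
From mathcomp Require Import all_boot all_order all_algebra.
From mathcomp Require Import reals.
From mathcomp Require Import complex.
From mathcomp Require Import ring zify.

Set Implicit Arguments.
Unset Strict Implicit.
Unset Printing Implicit Defensive.

Import GRing.Theory.
Local Open Scope ring_scope.

(** For l = m = 0 the series is exactly the one in Andrews' formula: its upper parameters are the
    pairs a, q/a and q^(-n), -q^(-n). So l and m measure the distance from that case, and each costs
    one sum. The very-well-poised sums all have A = y^2/q and third parameter y, so that the partner
    A q/y is y again. The two uses differ in what varies with the summation index of the 4phi3. For
    the sum over i everything is fixed, and an extra pair moves the third parameter from y to y q^k.
    For the sum over j, y = q^(-m-n) is fixed while b = q^(-K) follows the index K. In both cases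
    the coefficients can be taken out of the series. The two Sears transformations are forced by the
    shapes required: the first brings the product of the pair from q^(1+l) to q^(1-l), from which
    pairs of product q are reached; the second creates the lower parameters c, -c and a pair of
    product c^2/q. The final series thus have q-Watson shape, and a third use of Sears relates them
    to q-Whipple. *)

Section QPochhammer.
Variables (F : fieldType) (q : F).

Local Notation P x n := (qpoch x q n).

Lemma qpoch0 x : P x 0 = 1.
Proof. by rewrite /qpoch big_ord0. Qed.

Lemma qpochS x n : P x n.+1 = P x n * (1 - x * q ^+ n).
Proof. by rewrite /qpoch big_ord_recr. Qed.

Lemma qpochD x m n : P x (m + n) = P x m * P (x * q ^+ m) n.
Proof.
elim: n => [|n IHn]; first by rewrite addn0 qpoch0 mulr1.
by rewrite addnS !qpochS IHn -!mulrA -exprD.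
Qed.

Lemma qpochSl x n : P x n.+1 = (1 - x) * P (x * q) n.
Proof. by rewrite -add1n qpochD qpochS qpoch0 mul1r expr0 mulr1 expr1. Qed.

Lemma qpoch_neq0_leq x m n : (m <= n)%N -> P x n != 0 -> P x m != 0.
Proof. by move=> /subnK <-; rewrite addnC qpochD mulf_eq0 negb_or => /andP[]. Qed.

Lemma qpoch_factor_neq0 x n k : P x n != 0 -> (k < n)%N -> 1 - x * q ^+ k != 0.
Proof.
by move=> /prodf_neq0 nz lt_kn; apply: (nz (Ordinal lt_kn)).
Qed.

Lemma qpoch_factor_eq0 x n k : (k < n)%N -> x * q ^+ k = 1 -> P x n = 0.
Proof.
move=> lt_kn e; apply/eqP; apply: contraTT (eqxx (0 : F)) => nz.
by have := qpoch_factor_neq0 nz lt_kn; rewrite e subrr.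
Qed.

Lemma qpochs_nil n : qpochs [::] q n = 1.
Proof. by rewrite /qpochs big_nil. Qed.

Lemma qpochs_cons x xs n : qpochs (x :: xs) q n = P x n * qpochs xs q n.
Proof. by rewrite /qpochs big_cons. Qed.

Definition qpochsE := (qpochs_cons, qpochs_nil, mulr1).

End QPochhammer.

(** * Passage to base q^2, sign factors and q-binomials *)

Section QFactorials.
Variables (F : fieldType) (q : F).

Local Notation P x n := (qpoch x q n).

Lemma qpoch_mulN x n : P x n * P (- x) n = qpoch (x ^+ 2) (q ^+ 2) n.
Proof.
rewrite /qpoch -big_split; apply: eq_bigr => k _ /=.
by rewrite -exprM mulnC exprM; ring.
Qed.

Lemma qpoch_odd_even n :
  P q (2 * n) = qpoch q (q ^+ 2) n * (P q n * P (- q) n).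
Proof.
rewrite qpoch_mulN; elim: n => [|n IHn]; first by rewrite muln0 !qpoch0 !mulr1.
rewrite mulnS !qpochS IHn -!exprM !exprS expr0 exprM; ring.
Qed.

Definition qsign n : F := \prod_(k < n) - q ^+ k.

Lemma qsign0 : qsign 0 = 1.
Proof. exact: big_ord0. Qed.

Lemma qsignS n : qsign n.+1 = - (qsign n * q ^+ n).
Proof. by rewrite /qsign big_ord_recr /= mulrN. Qed.

Lemma qsignD m n : qsign (m + n) = qsign m * qsign n * q ^+ (m * n).
Proof.
elim: n => [|n IHn]; first by rewrite addn0 muln0 qsign0 !mulr1.
by rewrite addnS !qsignS IHn mulnS !exprD; ring.
Qed.

Lemma qsignE n : qsign n = (-1) ^+ n * q ^+ 'C(n, 2).
Proof.
elim: n => [|n IHn]; first by rewrite qsign0 mulr1.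
by rewrite qsignS IHn binS bin1 exprD exprS; ring.
Qed.

Lemma sqr_qsign n : qsign n ^+ 2 * q ^+ n = q ^+ (n * n).
Proof.
elim: n => [|n IHn]; first by rewrite qsign0 mulr1 expr1n.
rewrite qsignS mulnS mulSn !addSn !exprS !exprD -IHn; ring.
Qed.

Definition qbinomial n k : F := P q n / (P q k * P q (n - k)).

Hypothesis q_neq0 : q != 0.

Lemma expq_neq0 n : q ^+ n != 0.
Proof. by rewrite expf_neq0. Qed.

Lemma qsign_neq0 n : qsign n != 0.
Proof.
by apply/prodf_neq0 => k _; rewrite oppr_eq0 expq_neq0.
Qed.

End QFactorials.

Ltac nz := repeat first
  [ apply/andP; split | assumption | rewrite oppr_eq0 | apply: mulf_neq0
  | apply: invr_neq0 | apply: expf_neq0 | apply: qsign_neq0 | exact: oner_neq0 ].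

(** * Reversal of shifted factorials *)

Section Reversal.
Variables (F : fieldType) (q : F).
Hypothesis q_neq0 : q != 0.

Local Notation P x n := (qpoch x q n).
Local Notation qsign := (qsign q).

Lemma qpoch_rev x n : x != 0 ->
  P (q / (q ^+ n * x)) n = P x n / (x ^+ n * qsign n).
Proof.
move=> x0; elim: n => [|n IHn]; first by rewrite !qpoch0 qsign0 mulr1 divr1.
rewrite qpochSl (_ : q / _ * q = q / (q ^+ n * x)); last first.
  by rewrite exprS; field; nz.
rewrite IHn qpochS qsignS !exprS; field.
by nz.
Qed.

Lemma qpoch_expVq n k : P q (n + k) != 0 ->
  P (q ^- (n + k)) k = qsign n / (qsign (n + k) * q ^+ k) * (P q (n + k) / P q n).
Proof.
elim: k n => [|k IHk] n.
  by rewrite addn0 => nz0; rewrite qpoch0 expr0; field; nz.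
move=> nz.
rewrite qpochS addnS -addSn IHk ?addSn -?addnS //.
have nzn : P q n.+1 != 0.
  by apply: qpoch_neq0_leq nz; rewrite addnS ltnS leq_addr.
rewrite (qpochS q q n) in nzn *; move: nzn; rewrite mulf_eq0 negb_or => /andP[n1 n2].
rewrite qsignS addnS exprS (exprS q k) exprD; field.
by nz.
Qed.

End Reversal.

(** * The q-Saalschuetz sum and Sears' transformation *)

Section Sears.
Variables (F : fieldType) (q : F).
Hypothesis q_neq0 : q != 0.

Local Notation P x n := (qpoch x q n).
Local Notation qsign := (qsign q).
Local Notation qbin := (qbinomial q).

(** Bookkeeping shared by the inductions for the two basis expansions below: going to the next row
    multiplies each term by a factor that splits in two, one part keeping the index ([f]) and one
    raising it ([g]), as in Pascal's rule. *)
Lemma sum_pascal (f g h : nat -> F) k :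
    h 0%N = f 0%N -> h k.+1 = g k ->
    (forall j, (j < k)%N -> h j.+1 = f j.+1 + g j) ->
  \sum_(j < k.+2) h j = \sum_(j < k.+1) (f j + g j).
Proof.
move=> h0 hk hj; rewrite big_split /= big_ord_recl [in RHS]big_ord_recl h0.
rewrite [\sum_(j < k.+1) g j]big_ord_recr /= big_ord_recr /= /bump /= hk.
rewrite (eq_bigr (fun j : 'I_k => f j.+1 + g j)) => [|j _]; last exact: hj.
by rewrite big_split /= !addrA.
Qed.

Lemma qpoch_sub_neq0 n k : P q n != 0 -> P q (n - k) != 0.
Proof. by apply: qpoch_neq0_leq; rewrite leq_subr. Qed.

(* Induction on [k]: (1 - Y v q^k)(1 - Y u q^k) is a linear combination of 1 and
   (1 - u q^j)(1 - v q^j), which shifts the basis (u, v)_j to (u, v)_(j+1). *)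
Lemma polynomial_saalschuetz Y u v k : P q k != 0 ->
  P (Y * v) k * P (Y * u) k =
  \sum_(j < k.+1) qbin k j * (P u j * P v j)
     * (P (Y * u * v * q ^+ j) (k - j) * P Y (k - j) * Y ^+ j).
Proof.
elim: k => [|k IHk] nz.
  by rewrite big_ord1 /qbin !qpoch0 !expr0; field; rewrite oner_neq0.
have nzk : P q k != 0 by apply: qpoch_neq0_leq nz.
have k1 := qpoch_factor_neq0 nz (ltnSn k).
pose s j := qbin k j * (P u j * P v j)
     * (P (Y * u * v * q ^+ j) (k - j) * P Y (k - j) * Y ^+ j).
rewrite !qpochS mulrACA IHk // mulr_suml.
pose h j := qbin k.+1 j * (P u j * P v j)
     * (P (Y * u * v * q ^+ j) (k.+1 - j) * P Y (k.+1 - j) * Y ^+ j).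
rewrite -[RHS]/(\sum_(j < k.+2) h j) (sum_pascal (f := fun j => s j *
    ((1 - Y * q ^+ (k - j)) * (1 - Y * u * v * q ^+ (k + j))))
  (g := fun j => s j *
    (Y * q ^+ (k - j) * ((1 - u * q ^+ j) * (1 - v * q ^+ j))))) /h /=.
- apply: eq_bigr => -[j /= lt_jk] _; rewrite -mulrDr; congr (_ * _).
  have [d ->] : exists d, k = (d + j)%N by exists (k - j)%N; rewrite subnK.
  rewrite addnK !exprD; ring.
- rewrite /s /qbin !subn0 !qpoch0 addn0 !expr0 !mulr1 (qpochS _ _ k)
    (qpochS _ Y) (qpochS _ (Y * u * v)).
  by field; nz.
- rewrite /s /qbin !subnn !qpoch0 !qpochS exprS expr0; field.
  by nz.
move=> j lt_jk; rewrite /s /qbin.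
have [d ek] : exists d, k = (d + j.+1)%N by exists (k - j.+1)%N; rewrite subnK.
rewrite subSS {1}ek.
have -> : (k - j = d.+1)%N by rewrite ek addnS -addSn addnK.
have -> : (k - j.+1 = d)%N by rewrite ek addnK.
have nzj : P q j.+1 != 0 by apply: qpoch_neq0_leq nzk.
have nzd : P q d.+1 != 0 by apply: qpoch_neq0_leq nzk; rewrite ek addnS ltnS leq_addr.
move: nz nzk nzj nzd k1.
rewrite (_ : P (Y * u * v * q ^+ j) d.+1 =
   (1 - Y * u * v * q ^+ j) * P (Y * u * v * q ^+ j.+1) d); last first.
  by rewrite qpochSl exprS; congr (_ * qpoch _ _ _); ring.
rewrite ek !(qpochS _ q) !(qpochS _ u) !(qpochS _ v) (qpochS _ Y) (qpochS _ (_ * q ^+ _)).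
rewrite !mulf_eq0 !negb_or => /andP[A1 A2] _ /andP[A3 A4] /andP[A5 A6] _.
move: A1 A2 A3 A4 A5 A6; rewrite !exprD !exprS.
set Z := q ^+ j; set W := q ^+ d.
move=> A1 A2 A3 A4 A5 A6; field; nz.
Qed.


Lemma sum_triangle (f : nat -> nat -> F) n :
  \sum_(k < n.+1) \sum_(j < k.+1) f k j =
  \sum_(j < n.+1) \sum_(r < (n - j).+1) f (j + r)%N j.
Proof.
elim: n => [|n IHn]; first by rewrite !big_ord1.
rewrite big_ord_recr IHn [RHS]big_ord_recr /= subnn big_ord1 addn0.
rewrite [X in _ + X]big_ord_recr /= addrA; congr (_ + _).
rewrite -big_split /=; apply: eq_bigr => -[j /= lt_jn] _.
by rewrite subSn // [RHS]big_ord_recr /= addnS subnKC.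
Qed.

(** The balancing condition says e = q^(1-n)/(w Y) with w = g/a. Hence [P e n] and the factors
    containing Y e are reversals of (w Y; q)_n and (w; q)_(n-r), and the sum is
    [polynomial_saalschuetz] for w, a, Y. *)
Lemma saalschuetz a Y e g n :
    a != 0 -> Y != 0 -> g != 0 -> P q n != 0 -> e * g * Y * q ^+ n = a * q ->
  \sum_(r < n.+1) qbin n r * qsign (n - r) * (P a r * P Y r)
     * (P (Y * g * q ^+ r) (n - r) * P (Y * e * q ^+ r) (n - r)) =
  qsign n * Y ^+ n * (P e n * P g n).
Proof.
move=> a0 Y0 g0 nz balanced; pose w := g / a.
have w0 : w != 0 by rewrite /w; nz.
have qn0 := expq_neq0 q_neq0 n.
have eE : e = a * q / (g * Y * q ^+ n).
  by rewrite -balanced; field; nz.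
have -> : P e n = P (w * Y) n / ((w * Y) ^+ n * qsign n).
  rewrite -qpoch_rev //; last by nz.
  by congr qpoch; rewrite eE /w; field; nz.
have := polynomial_saalschuetz w a Y nz.
have -> : w * a = g by rewrite /w; field.
rewrite exprMn => saal.
apply: (mulIf (expf_neq0 n w0)); rewrite mulr_suml.
transitivity (P (w * Y) n * P g n); last first.
  by field; nz.
rewrite saal; apply: eq_bigr => -[r /= lt_rn] _.
have -> : P (Y * e * q ^+ r) (n - r) = P w (n - r) / (w ^+ (n - r) * qsign (n - r)).
  rewrite -qpoch_rev //; congr qpoch; rewrite eE /w.
  have -> : q ^+ n = q ^+ (n - r) * q ^+ r by rewrite -exprD subnK.
  by field; nz.
have -> : w ^+ n = w ^+ (n - r) * w ^+ r by rewrite -exprD subnK.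
rewrite (mulrC g); field; nz.
Qed.

(* The 4phi3 series with upper parameters q^(-n), A, B, C, lower parameters
   D, E, G and argument q, multiplied by [qsign n] (D, E, G; q)_n; the factor
   (q^(-n); q)_k q^k / (q; q)_k is qsign (n - k) / qsign n times a q-binomial. *)
Definition cleared_phi n A B C D E G :=
  \sum_(k < n.+1) qbin n k * qsign (n - k) * (P A k * P B k * P C k)
    * (P (D * q ^+ k) (n - k) * P (E * q ^+ k) (n - k) * P (G * q ^+ k) (n - k)).

(** The single relation on e g Y makes both series balanced. Expanding (Y u, Y v; q)_k by
    [polynomial_saalschuetz] and exchanging the sums leaves an inner sum that is [saalschuetz] with
    A, e, g shifted by q^j. *)
Lemma cleared_sears n A Y u v e g :
    A != 0 -> Y != 0 -> g != 0 -> P q n != 0 -> e * g * Y * q ^+ n = A * q ->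
  cleared_phi n A (Y * v) (Y * u) (Y * u * v) (Y * g) (Y * e) =
  Y ^+ n * cleared_phi n A u v (Y * u * v) e g.
Proof.
move=> A0 Y0 g0 nz balanced; rewrite /cleared_phi.
pose f k j := qbin n k * qsign (n - k) * P A k
   * (qbin k j * (P u j * P v j)
     * (P (Y * u * v * q ^+ j) (k - j) * P Y (k - j) * Y ^+ j))
    * (P (Y * u * v * q ^+ k) (n - k) * P (Y * g * q ^+ k) (n - k) * P (Y * e * q ^+ k) (n - k)).
transitivity (\sum_(k < n.+1) \sum_(j < k.+1) f k j).
  apply: eq_bigr => -[k /= le_kn] _.
  rewrite -mulr_suml -mulr_sumr -polynomial_saalschuetz ?mulrA //.
  by apply: qpoch_neq0_leq nz.
rewrite sum_triangle mulr_sumr; apply: eq_bigr => -[j /= lt_jn] _.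
rewrite ltnS in lt_jn.
have nzj : P q j != 0 by apply: qpoch_neq0_leq nz.
have nznj := qpoch_sub_neq0 j nz.
have en : q ^+ n = q ^+ (n - j) * q ^+ j by rewrite -exprD subnK.
have saal := @saalschuetz (A * q ^+ j) Y (e * q ^+ j) (g * q ^+ j) (n - j).
transitivity (qbin n j * (P u j * P v j) * P A j * Y ^+ j
    * P (Y * u * v * q ^+ j) (n - j)
    * \sum_(r < (n - j).+1) qbin (n - j) r * qsign (n - j - r)
        * (P (A * q ^+ j) r * P Y r)
        * (P (Y * (g * q ^+ j) * q ^+ r) (n - j - r)
           * P (Y * (e * q ^+ j) * q ^+ r) (n - j - r))); last first.
  have bal : e * q ^+ j * (g * q ^+ j) * Y * q ^+ (n - j) = A * q ^+ j * q.
    by rewrite [RHS]mulrAC -balanced en; ring.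
  rewrite {}saal ?mulf_neq0 ?expq_neq0 //.
  have -> : Y ^+ n = Y ^+ (n - j) * Y ^+ j by rewrite -exprD subnK.
  by ring.
rewrite mulr_sumr; apply: eq_bigr => -[r /= lt_rn] _.
rewrite ltnS in lt_rn.
have le_jr : (j + r <= n)%N by rewrite -leq_subRL.
have nzjr : P q (j + r) != 0 by apply: qpoch_neq0_leq nz.
have nzr : P q r != 0 by apply: qpoch_neq0_leq nzjr; rewrite leq_addl.
have nznjr : P q (n - j - r) != 0 by rewrite -subnDA; apply: qpoch_sub_neq0.
rewrite /f /qbin addKn subnDA (qpochD _ A).
have -> : P (Y * u * v * q ^+ j) (n - j) =
    P (Y * u * v * q ^+ j) r * P (Y * u * v * q ^+ (j + r)) (n - j - r).
  by rewrite -{1}(subnKC lt_rn) qpochD exprD mulrA.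
have eqs x : Y * (x * q ^+ j) * q ^+ r = Y * x * q ^+ (j + r).
  by rewrite exprD; ring.
by rewrite !eqs; field; nz.
Qed.

End Sears.

(** * Andrews' q-Whipple and q-Watson sums *)

Section Andrews.
Variables (F : fieldType) (q : F).
Hypothesis q_neq0 : q != 0.

Local Notation P x n := (qpoch x q n).
Local Notation qsign := (qsign q).
Local Notation qbin := (qbinomial q).

(* Same induction as for [polynomial_saalschuetz], in the basis (a, q/a)_k. *)
Lemma whipple_expansion a b c n : a * b = q -> qpoch (q ^+ 2) (q ^+ 2) n != 0 ->
  qpoch (a * c) (q ^+ 2) n * qpoch (b * c) (q ^+ 2) n =
  \sum_(k < n.+1) qbinomial (q ^+ 2) n k * (c ^+ k * q ^+ 'C(k, 2))
    * P (c * q ^+ k) (2 * (n - k)) * (P a k * P b k).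
Proof.
move=> ab; elim: n => [|n IHn] nz.
  by rewrite big_ord1 /qbinomial !qpoch0 !expr0; field; rewrite oner_neq0.
have nzn : qpoch (q ^+ 2) (q ^+ 2) n != 0 by apply: qpoch_neq0_leq nz.
have n1 := qpoch_factor_neq0 nz (ltnSn n).
pose s k := qbinomial (q ^+ 2) n k * (c ^+ k * q ^+ 'C(k, 2))
    * P (c * q ^+ k) (2 * (n - k)) * (P a k * P b k).
pose h k := qbinomial (q ^+ 2) n.+1 k * (c ^+ k * q ^+ 'C(k, 2))
    * P (c * q ^+ k) (2 * (n.+1 - k)) * (P a k * P b k).
rewrite !(qpochS _ _ n) mulrACA IHn // mulr_suml.
rewrite -[RHS]/(\sum_(j < n.+2) h j) (sum_pascal (f := fun k => s k *
    ((1 - c * q ^+ (2 * n - k)) * (1 - c * q ^+ (2 * n + k).+1)))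
  (g := fun k => s k *
    (c * q ^+ (2 * n - k) * ((1 - a * q ^+ k) * (1 - b * q ^+ k))))) /h /=.
- apply: eq_bigr => -[k /= lt_kn] _; rewrite -mulrDr; congr (_ * _).
  have [d ->] : exists d, n = (d + k)%N by exists (n - k)%N; rewrite subnK.
  have -> : (2 * (d + k) - k = 2 * d + k)%N by lia.
  rewrite -!exprM (_ : (2 * (d + k) = d + d + (k + k))%N); last by lia.
  rewrite (_ : (2 * d = d + d)%N); last by lia.
  rewrite !(exprD, exprS); set Z := q ^+ k; set W := q ^+ d.
  by rewrite -ab; ring.
- rewrite /s /qbinomial !subn0 !qpoch0 addn0 !expr0 !mulr1 mulnS !qpochS.
  by rewrite (exprS q (2 * n)); field; nz.
- rewrite /s /qbinomial !subnn ?muln0 !qpoch0 !qpochS ?qpoch0 (exprS c) binS bin1 exprD.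
  have -> : (2 * n - n = n)%N by lia.
  by field; nz.
move=> k lt_kn; rewrite /s /qbinomial.
have [d ek] : exists d, n = (d + k.+1)%N by exists (n - k.+1)%N; rewrite subnK.
rewrite subSS.
have -> : (n - k = d.+1)%N by rewrite ek addnS -addSn addnK.
have -> : (n - k.+1 = d)%N by rewrite ek addnK.
have -> : (2 * n - k.+1 = 2 * d + k.+1)%N by lia.
have -> : (2 * n - k = 2 * d + k.+2)%N by lia.
have nzk : qpoch (q ^+ 2) (q ^+ 2) k.+1 != 0 by apply: qpoch_neq0_leq nzn.
have nzd : qpoch (q ^+ 2) (q ^+ 2) d.+1 != 0.
  by apply: qpoch_neq0_leq nzn; rewrite ek addnS ltnS leq_addr.
rewrite (_ : P (c * q ^+ k) (2 * d.+1) = (1 - c * q ^+ k) *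
   P (c * q ^+ k.+1) (2 * d) * (1 - c * q ^+ k * q ^+ (2 * d).+1)); last first.
  by rewrite mulnS qpochS qpochSl (exprS q k); congr (_ * qpoch _ _ _ * _); ring.
rewrite (_ : P (c * q ^+ k.+1) (2 * d.+1) =  P (c * q ^+ k.+1) (2 * d)
   * (1 - c * q ^+ k.+1 * q ^+ (2 * d)) * (1 - c * q ^+ k.+1 * q ^+ (2 * d).+1)); last first.
  by rewrite mulnS !qpochS.
move: nz nzn nzk nzd n1.
rewrite ek !(qpochS _ (q ^+ 2)) !(qpochS _ a) !(qpochS _ b).
rewrite !mulf_eq0 !negb_or => /andP[A1 A2] _ /andP[A3 A4] /andP[A5 A6] _.
move: A1 A2 A3 A4 A5 A6; rewrite binS bin1 -!exprM.
have -> : (2 * (d + k.+1) + k.+1 = d + d + (k + k + k).+3)%N by lia.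
have -> : (2 * d = d + d)%N by lia.
have -> : (2 * (d + k.+1) = d + d + (k + k).+2)%N by lia.
have -> : (2 * k = k + k)%N by lia.
rewrite !(exprD, exprS) !expr0 !mulr1.
set Z := q ^+ k; set W := q ^+ d.
move=> A1 A2 A3 A4 A5 A6; field; nz.
Qed.


Lemma qpoch_NexpVq d k :
  P (- q ^- (d + k)) k * P (- q) d =
  q ^+ 'C(k, 2) / (q ^+ (d + k)) ^+ k * P (- q) (d + k).
Proof.
elim: k d => [|k IHk] d; first by rewrite addn0 qpoch0 divr1 !mul1r.
rewrite qpochS addnS -addSn.
have := IHk d.+1; rewrite (qpochS _ (- q) d) => IH.
have -> : - q ^- (d.+1 + k) * q ^+ k = - (q * q ^+ d)^-1.
  by rewrite exprD exprS; field; nz.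
rewrite binS bin1 (exprD _ 'C(k, 2)) (exprS (q ^+ (d.+1 + k))).
transitivity (P (- q ^- (d.+1 + k)) k * (P (- q) d * (1 - - q * q ^+ d)) / (q * q ^+ d)).
  by field; nz.
by rewrite IH exprD exprS; field; nz.
Qed.

(** Agrees term by term with [whipple_expansion]: the factors of the lower parameter q^(1-2n)/c are
    reversals of (c q^n; q)_(n-k) and extend (c q^k; q)_(n-k) to length 2(n-k), while (q, -q; q)_k =
    (q^2; q^2)_k puts the binomial in base q^2. *)
Lemma whipple a b c n : a * b = q -> c != 0 -> P q n != 0 -> P (- q) n != 0 ->
  cleared_phi q n (- q ^- n) a b c (q / (q ^+ (2 * n) * c)) (- q) =
  P (- q) n / (c * q ^+ n) ^+ n
    * (qpoch (a * c) (q ^+ 2) n * qpoch (b * c) (q ^+ 2) n).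
Proof.
move=> ab c0 nz nzN; rewrite (whipple_expansion c ab); last first.
  by rewrite -qpoch_mulN mulf_neq0.
rewrite mulr_sumr; apply: eq_bigr => -[k /= lt_kn] _; rewrite ltnS in lt_kn.
have [d en] : exists d, n = (d + k)%N by exists (n - k)%N; rewrite subnK.
rewrite en addnK.
have -> : P (q / (q ^+ (2 * (d + k)) * c) * q ^+ k) d =
    P (c * q ^+ (d + k)) d / ((c * q ^+ (d + k)) ^+ d * qsign d).
  rewrite -qpoch_rev //; last by nz.
  by congr qpoch; rewrite mul2n -addnn !exprD; field; nz.
have -> : P (c * q ^+ k) (2 * d) = P (c * q ^+ k) d * P (c * q ^+ (d + k)) d.
  by rewrite mul2n -addnn qpochD -mulrA -exprD (addnC k).
move: nz nzN; rewrite en => nz nzN.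
have nzd : P q d != 0 by apply: qpoch_neq0_leq nz; rewrite leq_addr.
have nzk : P q k != 0 by apply: qpoch_neq0_leq nz; rewrite leq_addl.
have nzNd : P (- q) d != 0 by apply: qpoch_neq0_leq nzN; rewrite leq_addr.
have nzNk : P (- q) k != 0 by apply: qpoch_neq0_leq nzN; rewrite leq_addl.
have -> : P (- q * q ^+ k) d = P (- q) (d + k) / P (- q) k.
  by rewrite addnC qpochD; field.
have -> : P (- q ^- (d + k)) k =
    q ^+ 'C(k, 2) / (q ^+ (d + k)) ^+ k * P (- q) (d + k) / P (- q) d.
  by rewrite -qpoch_NexpVq; field.
rewrite /qbinomial addnK -!qpoch_mulN (exprD (c * q ^+ (d + k)) d k) !exprMn.
field; nz.
Qed.

(** Sears with Y = q/c carries this series to [whipple]: then Y u v = c, so the new pair Y v, Y u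
    has product q, and the lower parameter -c becomes -q. *)
Lemma watson u v c n : u * v * q = c ^+ 2 -> u != 0 -> v != 0 -> c != 0 ->
    P q n != 0 -> P (- q) n != 0 ->
  cleared_phi q n (- q ^- n) u v c (- c) (q ^- (2 * n)) =
  P (- q) n / q ^+ (n + n * n)
    * (qpoch (q * u) (q ^+ 2) n * qpoch (q * v) (q ^+ 2) n).
Proof.
move=> uv u0 v0 c0 nz nzN.
have qn0 := expq_neq0 q_neq0 n.
pose Y := q / c.
have Y0 : Y != 0 by rewrite /Y; nz.
have cE : Y * u * v = c.
  by apply: (mulIf c0); rewrite -expr2 -uv /Y; field.
have abE : Y * v * (Y * u) = q.
  rewrite (_ : _ * _ = Y * (Y * u * v)); last by ring.
  by rewrite cE /Y; field.
have bal : - c * q ^- (2 * n) * Y * q ^+ n = - q ^- n * q.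
  by rewrite /Y mul2n -addnn exprD; field; nz.
have A0 : - q ^- n != 0 by nz.
have q2n0 : q ^- (2 * n) != 0 by rewrite invr_neq0 ?expf_neq0.
have := cleared_sears q_neq0 u v A0 Y0 q2n0 nz bal.
rewrite cE (_ : Y * q ^- (2 * n) = q / (q ^+ (2 * n) * c)); last first.
  by rewrite /Y mul2n -addnn exprD; field; nz.
rewrite (_ : Y * - c = - q); last by rewrite /Y; field.
rewrite whipple // => E.
apply: (mulfI (expf_neq0 n Y0)); rewrite -E.
rewrite (_ : Y * v * c = q * v); last by rewrite /Y; field.
rewrite (_ : Y * u * c = q * u); last by rewrite /Y; field.
rewrite /Y !exprMn exprVn -exprM exprD; field; nz.
Qed.

End Andrews.

(** * Terminating very-well-poised 6phi5 sums *)

Section VeryWellPoised.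
Variables (F : fieldType) (q : F).
Hypothesis q_neq0 : q != 0.

Local Notation P x n := (qpoch x q n).

(* (1 - A q^(2i)) / (1 - A) * (A; q)_i with A = y^2 / q, written so that it is
   also meaningful when A = 1. *)
Definition vwp_weight y i : F :=
  if i is i'.+1 then P (y ^+ 2) i' * (1 - y ^+ 2 * q ^+ (2 * i').+1) else 1.

(* The remaining factors of a terminating 6phi5 series with A = (b w)^2 / q and
   third parameter y = b w, whose contribution cancels since A q / y = y. *)
Definition vwp_factor l b w i : F :=
  P b i * P (q ^- l) i
  / (P q i * P (b * w ^+ 2) i * P ((b * w) ^+ 2 * q ^+ l) i)
  * (q ^+ l * w) ^+ i.

Lemma q_pow_sub1_neq0 l k : P q l != 0 -> (k < l)%N -> 1 - q ^- l * q ^+ k != 0.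
Proof.
move=> nz lt_kl; have [d el] : exists d, l = (d.+1 + k)%N.
  by exists (l - k.+1)%N; lia.
have := qpoch_factor_neq0 nz (k := d); rewrite el => /(_ _).
move=> h; have {h} : 1 - q * q ^+ d != 0 by apply: h; lia.
apply: contraNneq => /eqP; rewrite subr_eq0 => /eqP e.
rewrite subr_eq0 -exprS.
have -> : q ^+ d.+1 = (q ^- (d.+1 + k) * q ^+ k)^-1.
  by rewrite (exprD q d.+1); field; nz.
by rewrite -e invr1.
Qed.


Lemma vwp_tailS l b w i :
  vwp_factor l b w i.+1 = vwp_factor l b w i *
   ((1 - b * q ^+ i) * (1 - q ^- l * q ^+ i) /
    ((1 - q * q ^+ i) * (1 - b * w ^+ 2 * q ^+ i)
     * (1 - (b * w) ^+ 2 * q ^+ l * q ^+ i))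
    * (q ^+ l * w)).
Proof. by rewrite /vwp_factor !qpochS (exprS (q ^+ l * w)) !invfM; ring. Qed.

Lemma vwp_tail_succ l b w i :
    P q l.+1 != 0 -> P ((b * w) ^+ 2) (2 * l.+1) != 0 -> (i <= l)%N ->
  vwp_factor l.+1 b w i = vwp_factor l b w i *
   (q ^+ i * (1 - q ^- l.+1) * (1 - (b * w) ^+ 2 * q ^+ l) /
    ((1 - q ^- l.+1 * q ^+ i) * (1 - (b * w) ^+ 2 * q ^+ l * q ^+ i))).
Proof.
move=> nz; rewrite /vwp_factor; set y := b * w => ny le_il.
have e1 : P (q ^- l.+1) i * (1 - q ^- l.+1 * q ^+ i) = (1 - q ^- l.+1) * P (q ^- l) i.
  rewrite -qpochS qpochSl; congr (_ * qpoch _ _ _).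
  by rewrite exprS; field; nz.
have e2 : P (y ^+ 2 * q ^+ l) i * (1 - y ^+ 2 * q ^+ l * q ^+ i) =
    (1 - y ^+ 2 * q ^+ l) * P (y ^+ 2 * q ^+ l.+1) i.
  by rewrite -qpochS qpochSl; congr (_ * qpoch _ _ _); rewrite (exprSr q l) mulrA.
have n1 := q_pow_sub1_neq0 nz (k := i) le_il.
have f k : (k < 2 * l.+1)%N -> 1 - y ^+ 2 * q ^+ k != 0.
  by apply: qpoch_factor_neq0.
have n2 : 1 - y ^+ 2 * q ^+ l * q ^+ i != 0.
  by rewrite -mulrA -exprD; apply: f; lia.
have n3 : 1 - y ^+ 2 * q ^+ l != 0 by apply: f; lia.
have n4 : P (y ^+ 2 * q ^+ l) i != 0.
  have := ny; rewrite (_ : 2 * l.+1 = l + (l + 2))%N; last by lia.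
  rewrite qpochD mulf_eq0 negb_or => /andP[_].
  by apply: qpoch_neq0_leq; lia.
have -> : P (y ^+ 2 * q ^+ l.+1) i = P (y ^+ 2 * q ^+ l) i * (1 - y ^+ 2 * q ^+ l * q ^+ i)
    / (1 - y ^+ 2 * q ^+ l) by rewrite e2; field.
have -> : P (q ^- l.+1) i = (1 - q ^- l.+1) * P (q ^- l) i / (1 - q ^- l.+1 * q ^+ i).
  by rewrite -e1 mulfK.
have -> : (q ^+ l.+1 * w) ^+ i = q ^+ i * (q ^+ l * w) ^+ i.
  by rewrite (exprS q l) -exprMn !mulrA.
rewrite !invfM invrK; ring.
Qed.

Lemma vwp_sum_step0 (b w L : F) : 1 - b * w ^+ 2 * L != 0 -> 1 - b * w * L != 0 ->
    1 - (b * w) ^+ 2 * L != 0 ->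
  1 - (1 - (b * w) ^+ 2 * L) * (1 - w * L)
      / ((1 - b * w ^+ 2 * L) * (1 - b * w * L)) =
  (1 - b) * (1 - b * w) / (1 - (b * w) ^+ 2 * L)
  * (w * L * (1 - (b * w) ^+ 2 * L) / ((1 - b * w ^+ 2 * L) * (1 - b * w * L))).
Proof. by move=> n1 n2 n3; field; nz. Qed.

(** Telescoping step for [vwp_sum], with L = q^l and Z = q^r as free variables and the common factor
    of the terms at r divided out: partial sum at r plus next summand gives partial sum at r+1. *)
Lemma vwp_sum_step (b w L Z : F) : L != 0 ->
    1 - b * w ^+ 2 * L != 0 -> 1 - b * w * L != 0 ->
    1 - (b * w) ^+ 2 * L != 0 -> 1 - (b * w) ^+ 2 * L * Z != 0 ->
    1 - (b * w) ^+ 2 * L * (q * Z) != 0 -> 1 - q * Z != 0 ->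
    1 - b * w ^+ 2 * Z != 0 -> L - Z != 0 ->
  (1 - b * Z) * (1 - b * w * Z) / (1 - (b * w) ^+ 2 * L * Z)
  * (w * L * (1 - (b * w) ^+ 2 * L) / ((1 - b * w ^+ 2 * L) * (1 - b * w * L)))
  + (1 - (b * w) ^+ 2 * (Z * Z * q))
  * ((1 - b * Z) * (L - Z) / ((1 - q * Z) * (1 - b * w ^+ 2 * Z)
      * (1 - (b * w) ^+ 2 * L * Z)) * w
  * (Z * (q * L - 1) * (1 - (b * w) ^+ 2 * L)
       / ((L - Z) * (1 - (b * w) ^+ 2 * L * (q * Z)))
     - (1 - (b * w) ^+ 2 * L) * (1 - w * L)
      / ((1 - b * w ^+ 2 * L) * (1 - b * w * L))))
  = (1 - (b * w) ^+ 2 * Z)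
    * ((1 - b * Z) * (L - Z) / ((1 - q * Z) * (1 - b * w ^+ 2 * Z)
      * (1 - (b * w) ^+ 2 * L * Z)) * w)
    * ((1 - b * (q * Z)) * (1 - b * w * (q * Z)) / (1 - (b * w) ^+ 2 * L * (q * Z)))
  * (w * L * (1 - (b * w) ^+ 2 * L) / ((1 - b * w ^+ 2 * L) * (1 - b * w * L))).
Proof. by move=> *; field; nz. Qed.

Lemma ltn_add_double l k : (k <= l)%N -> (l + k < 2 * l.+1)%N.
Proof. lia. Qed.

(** Induction on l by creative telescoping: [rho] is the quotient of the right-hand sides at l+1 and
    l, so the sum for l+1 minus rho times the sum for l has to vanish. *)
Lemma vwp_sum l b w : P q l != 0 -> P ((b * w) ^+ 2) (2 * l) != 0 ->
    P (b * w ^+ 2) l != 0 -> P (b * w) l != 0 ->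
  \sum_(i < l.+1) vwp_weight (b * w) i * vwp_factor l b w i =
  P ((b * w) ^+ 2) l * P w l / (P (b * w ^+ 2) l * P (b * w) l).
Proof.
elim: l => [|l IHl] nzq nzx nzxb nzy.
  by rewrite big_ord1 /vwp_factor /= !qpoch0 !expr0; field; nz.
have nzq' : P q l != 0 by apply: qpoch_neq0_leq nzq.
have nzxb' : P (b * w ^+ 2) l != 0 by apply: qpoch_neq0_leq nzxb.
have nzy' : P (b * w) l != 0 by apply: qpoch_neq0_leq nzy.
have nzx' : P ((b * w) ^+ 2) (2 * l) != 0 by apply: qpoch_neq0_leq nzx; rewrite leq_mul2l leqnSn.
have ny1 := qpoch_factor_neq0 nzy (ltnSn l).
have nxb1 := qpoch_factor_neq0 nzxb (ltnSn l).
have f k : (k < 2 * l.+1)%N -> 1 - (b * w) ^+ 2 * q ^+ k != 0.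
  by apply: qpoch_factor_neq0.
have fl : 1 - (b * w) ^+ 2 * q ^+ l != 0.
  by apply: (f l); rewrite -{1}(addn0 l) ltn_add_double.
pose rho := (1 - (b * w) ^+ 2 * q ^+ l) * (1 - w * q ^+ l)
  / ((1 - b * w ^+ 2 * q ^+ l) * (1 - b * w * q ^+ l)).
pose kappa := w * q ^+ l * (1 - (b * w) ^+ 2 * q ^+ l)
     / ((1 - b * w ^+ 2 * q ^+ l) * (1 - b * w * q ^+ l)).
(* [H] is the partial sum of the q-Zeilberger recurrence in [l]. *)
pose H r := P ((b * w) ^+ 2) r * vwp_factor l b w r
  * ((1 - b * q ^+ r) * (1 - b * w * q ^+ r)
     / (1 - (b * w) ^+ 2 * q ^+ l * q ^+ r) * kappa).
have partial r : (r <= l)%N ->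
    \sum_(i < r.+1) vwp_weight (b * w) i * (vwp_factor l.+1 b w i - rho * vwp_factor l b w i) = H r.
  elim: r => [|r IHr] le_rl.
    rewrite big_ord1 /H /vwp_factor /= !qpoch0 !expr0 !mulr1 !divr1 !mul1r.
rewrite mulr1. by rewrite vwp_sum_step0.
  rewrite big_ord_recr /= IHr; last exact: ltnW.
rewrite vwp_tail_succ // /H vwp_tailS qpochS.
  have n2 : 1 - (b * w) ^+ 2 * q ^+ l * (q * q ^+ r) != 0.
    by rewrite -exprS -mulrA -exprD; apply: (f (l + r.+1)%N); exact: ltn_add_double.
  have n4 : 1 - (b * w) ^+ 2 * q ^+ l * q ^+ r != 0.
    by rewrite -mulrA -exprD; apply: (f (l + r)%N); apply: ltn_add_double; exact: ltnW.
  have n5 := qpoch_factor_neq0 nzxb' le_rl.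
  have n6 := qpoch_factor_neq0 nzq' le_rl.
  have n7 : q ^+ l - q ^+ r != 0.
    have := q_pow_sub1_neq0 nzq' le_rl; apply: contraNneq => /eqP.
    by rewrite subr_eq0 => /eqP <-; rewrite mulVf ?expf_neq0 // subrr.
  have l0 := expq_neq0 q_neq0 l.
  have E := vwp_sum_step l0 nxb1 ny1 fl n4 n2 n6 n5 n7.
  have eT : (1 - b * q ^+ r) * (1 - q ^- l * q ^+ r)
      / ((1 - q * q ^+ r) * (1 - b * w ^+ 2 * q ^+ r)
         * (1 - (b * w) ^+ 2 * q ^+ l * q ^+ r)) * (q ^+ l * w) =
      (1 - b * q ^+ r) * (q ^+ l - q ^+ r)
      / ((1 - q * q ^+ r) * (1 - b * w ^+ 2 * q ^+ r)
         * (1 - (b * w) ^+ 2 * q ^+ l * q ^+ r)) * w.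
    rewrite [RHS]mulrAC [LHS]mulrAC; congr (_ / _).
    by field.
  have eS : q ^+ r.+1 * (1 - q ^- l.+1) / (1 - q ^- l.+1 * q ^+ r.+1) =
     q ^+ r * (q * q ^+ l - 1) / (q ^+ l - q ^+ r).
    by rewrite !exprS; field; nz.
  have eZ : q ^+ (2 * r).+1 = q ^+ r * q ^+ r * q.
    by rewrite exprSr mul2n -addnn exprD.
  rewrite eT eZ {eT eZ}.
  have eS' : q ^+ r.+1 * (1 - q ^- l.+1) * (1 - (b * w) ^+ 2 * q ^+ l)
      / ((1 - q ^- l.+1 * q ^+ r.+1) * (1 - (b * w) ^+ 2 * q ^+ l * q ^+ r.+1)) =
     q ^+ r * (q * q ^+ l - 1) * (1 - (b * w) ^+ 2 * q ^+ l)
      / ((q ^+ l - q ^+ r) * (1 - (b * w) ^+ 2 * q ^+ l * (q * q ^+ r))).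
    by rewrite -[LHS]mulf_div eS [LHS]mulf_div (exprS q r).
  rewrite {}eS' {eS} (exprS q r); move: E; rewrite -/rho -/kappa.
  set X := P ((b * w) ^+ 2) r; set T := vwp_factor l b w r.
  set a1 := _ / _ * kappa; set a2 := 1 - _ * (_ * _ * q).
  set a3 := _ / _ * w; set a4 := _ / _; set a5 := 1 - _ * q ^+ r.
  set a6 := _ / _ => E.
  transitivity (X * T * (a1 + a2 * (a3 * (a4 - rho)))); first by ring.
  by rewrite E; ring.
(* The sum for l stops at i = l, so the extra top term of the sum for l+1 must cancel the telescoped
   part by itself. *)
have last_term : H l + vwp_weight (b * w) l.+1 * vwp_factor l.+1 b w l.+1 = 0.
  rewrite /H /=.
  have n1 : 1 - (b * w) ^+ 2 * q ^+ l * q ^+ l != 0.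
    by rewrite -mulrA -exprD; apply: (f (l + l)%N); exact: ltn_add_double.
  have n2 : 1 - (b * w) ^+ 2 * q ^+ l * (q * q ^+ l) != 0.
    rewrite -mulrA (mulrCA _ q) -exprD -exprS; apply: (f (l + l).+1).
    by rewrite mul2n -addnn addSn addnS.
  have n3 := qpoch_factor_neq0 nzq (ltnSn l).
  rewrite vwp_tailS vwp_tail_succ //.
  have -> : q ^+ (2 * l).+1 = q ^+ l * q ^+ l * q.
    by rewrite exprSr mul2n -addnn exprD.
  rewrite !(exprS q l) /kappa.
  have l0 := expq_neq0 q_neq0 l.
  set X := P ((b * w) ^+ 2) l; set T := vwp_factor l b w l.
  have n4 : 1 - (b * w) ^+ 2 * (q * q ^+ l) * q ^+ l != 0.
    rewrite (_ : 1 - _ = 1 - (b * w) ^+ 2 * q ^+ l * (q * q ^+ l)) //; ring.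
  have n5 : q - 1 != 0.
    have := qpoch_factor_neq0 nzq (ltn0Sn l).
    by rewrite mulr1 -oppr_eq0 opprB.
  move: n1 n2 n3 n4 n5 l0 fl ny1 nxb1 q_neq0; set L := q ^+ l.
  clearbody X T L; clear=> *.
  by field; nz.
rewrite big_ord_recr /=.
have -> : \sum_(i < l.+1) vwp_weight (b * w) i * vwp_factor l.+1 b w i =
    H l + rho * \sum_(i < l.+1) vwp_weight (b * w) i * vwp_factor l b w i.
  rewrite -partial // mulr_sumr -big_split /=.
  by apply: eq_bigr => i _; ring.
rewrite addrAC last_term add0r IHl // !qpochS /rho.
field; nz.
Qed.

(** With y = b w, the extra pair equals (y, q/y; q)_k times (y q^k; q)_i / (y q^(-k); q)_i q^(-ik)
    when no denominator vanishes. So this is the 6phi5 sum with third parameter y q^k instead of y,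
    in a form that does not divide by (y q^(-k); q)_i. *)
Lemma vwp_sum_reciprocal_pair l b w k : b != 0 -> w != 0 ->
    P q l != 0 -> P ((b * w) ^+ 2) (2 * l) != 0 ->
    P (b * w ^+ 2) l != 0 -> P (b * w) l != 0 -> P (q / (w * q ^+ l)) k != 0 ->
  \sum_(i < l.+1) vwp_weight (b * w) i * vwp_factor l b w i
    * (P (b * w * q ^+ i) k * P (q / (b * w * q ^+ i)) k) =
  P ((b * w) ^+ 2) l * P w l / (P (b * w ^+ 2) l * P (b * w) l)
  * (P (b * w) k * P (q / (b * w * q ^+ l)) k)
  * (P (q / w) k / P (q / (w * q ^+ l)) k).
Proof.
move=> b0 w0 nzq nzx nzxb nzy.
elim: k => [|k IHk] nzk.
  rewrite !qpoch0 divr1 !mulr1 -vwp_sum //.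
  by apply: eq_bigr => i _; rewrite !qpoch0 !mulr1.
have nzk' : P (q / (w * q ^+ l)) k != 0 by apply: qpoch_neq0_leq nzk.
have nk := qpoch_factor_neq0 nzk (ltnSn k).
have l0 := expq_neq0 q_neq0 l.
pose e i := P (b * w * q ^+ i) k * P (q / (b * w * q ^+ i)) k.
pose rho := (1 - b * w * q ^+ k) * (1 - q / (b * w * q ^+ l) * q ^+ k)
   * (1 - q / w * q ^+ k).
(* [H] is the partial sum of the q-Zeilberger recurrence in [k]; it vanishes at
   [r = l].  A recurrence in [l] would divide by 1 - q^(k-l)/y, which may be 0. *)
pose H r := - (P ((b * w) ^+ 2) r * vwp_factor l b w r * e r
  * ((1 - b * q ^+ r) * (1 - q ^- l * q ^+ r) * (1 - b * w * q ^+ r * q ^+ k)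
     * (q * q ^+ k) / (b * w * q ^+ r))).
have partial r : (r <= l)%N ->
    \sum_(i < r.+1) vwp_weight (b * w) i * vwp_factor l b w i
      * (e i * ((1 - b * w * q ^+ i * q ^+ k) * (1 - q / (b * w * q ^+ i) * q ^+ k))
         * (1 - q / (w * q ^+ l) * q ^+ k) - rho * e i) = H r.
  elim: r => [|r IHr] le_rl.
    rewrite big_ord1 /H /rho /vwp_factor /= !qpoch0 !expr0 !mulr1 !divr1 !mul1r.
    by field; nz.
  rewrite big_ord_recr /= IHr; last exact: ltnW.
  rewrite /H vwp_tailS qpochS.
  have n1 := qpoch_factor_neq0 nzy le_rl.
  have n4 : 1 - (b * w) ^+ 2 * q ^+ l * q ^+ r != 0.
    rewrite -mulrA -exprD; apply: (qpoch_factor_neq0 nzx).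
    by rewrite mul2n -addnn ltn_add2l.
  have n5 := qpoch_factor_neq0 nzxb le_rl.
  have n6 := qpoch_factor_neq0 nzq le_rl.
  have n7 : b * w * q ^+ r - 1 != 0 by rewrite -oppr_eq0 opprB.
  have r0 := expq_neq0 q_neq0 r.
  have e1 : P (b * w * q ^+ r.+1) k = P (b * w * q ^+ r) k
      * (1 - b * w * q ^+ r * q ^+ k) / (1 - b * w * q ^+ r).
    rewrite -qpochS qpochSl (exprSr q r) (mulrA (b * w)); field; nz.
  have e2 : P (q / (b * w * q ^+ r)) k = P (q / (b * w * q ^+ r.+1)) k
      * (b * w * q ^+ r - q ^+ k) / (b * w * q ^+ r - 1).
    have : P (q / (b * w * q ^+ r.+1)) k * (1 - q / (b * w * q ^+ r.+1) * q ^+ k) =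
        (1 - q / (b * w * q ^+ r.+1)) * P (q / (b * w * q ^+ r)) k.
      rewrite -qpochS qpochSl; congr (_ * qpoch _ _ _).
      by rewrite (exprS q r); field; nz.
    rewrite (exprS q r) => e2; apply: (mulIf n7).
    apply: (mulIf (invr_neq0 (mulf_neq0 (mulf_neq0 b0 w0) r0))).
    transitivity ((1 - q / (b * w * (q * q ^+ r))) * P (q / (b * w * q ^+ r)) k).
      by field; nz.
    by rewrite -e2; field; nz.
  have -> : q ^+ (2 * r).+1 = q ^+ r * q ^+ r * q.
    by rewrite exprSr mul2n -addnn exprD.
  rewrite /e e1 e2 /rho.
  set X := P ((b * w) ^+ 2) r; set T := vwp_factor l b w r.
  set E1 := P (b * w * q ^+ r) k; set E2 := P (q / (b * w * q ^+ r.+1)) k.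
  rewrite !(exprS q r).
  move: n1 n4 n5 n6 n7 r0 q_neq0 b0 w0 l0; set L := q ^+ l; set Z := q ^+ r.
  set K := q ^+ k.
  clearbody X T E1 E2 L Z K; clear=> *.
  by field; nz.
have /eqP := partial l (leqnn l).
rewrite /H mulVf // subrr mulr0 !mul0r mulr0 oppr0 => /eqP vanish.
apply: (mulIf nk).
transitivity (rho * \sum_(i < l.+1) vwp_weight (b * w) i * vwp_factor l b w i * e i).
  apply/eqP; rewrite mulr_suml mulr_sumr -subr_eq0 -sumrB; apply/eqP.
  rewrite -[RHS]vanish; apply: eq_bigr => i _; rewrite !qpochS /e; ring.
rewrite IHk // !qpochS /rho.
have nk' : w * q ^+ l - q * q ^+ k != 0.
  apply: contraNneq nk => /eqP; rewrite subr_eq0 => /eqP e0.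
  by rewrite mulrAC -e0 divff ?subrr //; nz.
by field; nz.
Qed.

End VeryWellPoised.

(** * Reduction to symmetric pairs: the sum over j *)

Section Reduction.
Variables (F : fieldType) (q : F).
Hypothesis q_neq0 : q != 0.

Local Notation P x n := (qpoch x q n).
Local Notation qsign := (qsign q).
Local Notation qbin := (qbinomial q).
Local Notation vwp := (vwp_weight q).
Local Notation vwp_tail := (vwp_factor q).

Lemma sum_ord_trunc (f : nat -> F) m n : (m <= n)%N ->
    (forall j, (m < j <= n)%N -> f j = 0) ->
  \sum_(j < n.+1) f j = \sum_(j < m.+1) f j.
Proof.
move=> le_mn f0; rewrite -!(big_mkord xpredT f).
rewrite (big_cat_nat (n := m.+1)) //= [X in _ + X]big_nat_cond [X in _ + X]big1 ?addr0 //.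
by move=> j /andP[/andP[lt_mj lt_jn] _]; apply: f0; rewrite lt_mj.
Qed.

Lemma qpoch_expVq_eq0 m j : (m < j)%N -> P (q ^- m) j = 0.
Proof.
by move=> lt_mj; apply: (qpoch_factor_eq0 lt_mj); rewrite mulVf ?expf_neq0.
Qed.

Lemma qpoch_expVq_neq0 m j : (j <= m)%N -> P q m != 0 -> P (q ^- m) j != 0.
Proof.
move=> /subnK <- nz; rewrite qpoch_expVq //.
have nz' : P q (m - j) != 0 by apply: qpoch_neq0_leq nz; rewrite leq_addr.
by nz.
Qed.

(** Term r of the j-th series feeds index K = j + r of the target. The last factor on the right is
    the part of [vwp_factor m (q ^- K) (q ^+ K / q ^+ M) j] that depends on K. *)
Lemma reduction_term j r d m u v c : let K := (j + r)%N in let M := (j + r + d)%N in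
    P q (2 * M) != 0 ->
  let g (e : F) := (P (c * q ^+ K) d * P (- (c * q ^+ K)) d * e) in
  P (- q ^- M) j * (P u j * P v j) * (q ^+ m) ^+ j
  * (qbin (r + d) r * qsign d
     * (P (- q ^- (r + d)) r * P (u * q ^+ j) r * P (v * q ^+ j) r)
     * g (P (q ^- (2 * (r + d)) * q ^+ r) d)) =
  qbin M K * qsign d * (P (- q ^- M) K * P u K * P v K)
  * g (P (q ^+ K / q ^+ (2 * M)) d)
  * (P (q ^- K) j / P (q ^+ K / q ^+ (2 * M)) j
     * (q ^+ m * (q ^+ K / q ^+ M)) ^+ j).
Proof.
move=> K M nz g.
have ex : q ^+ K / q ^+ (2 * M) = q ^- (j + r + 2 * d).
  rewrite /K /M (_ : (2 * _ = j + r + (j + r + 2 * d))%N); last by lia.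
  by rewrite (exprD q (j + r) (j + r + 2 * d)); field; nz.
have nz2 : P q (j + r + 2 * d) != 0 by apply: qpoch_neq0_leq nz; rewrite /M; lia.
have nzM : P q M != 0 by apply: qpoch_neq0_leq nz; lia.
have nzK : P q K != 0 by apply: qpoch_neq0_leq nzM; rewrite /M /K; lia.
have nzN : P q (r + d) != 0 by apply: qpoch_neq0_leq nzM; rewrite /M; lia.
have nzr : P q r != 0 by apply: qpoch_neq0_leq nzN; lia.
have nzd : P q d != 0 by apply: qpoch_neq0_leq nzN; lia.
have nxj : P (q ^- (j + r + 2 * d)) j != 0 by apply: qpoch_expVq_neq0 => //; lia.
rewrite ex.
have -> : P (q ^- (2 * (r + d)) * q ^+ r) d =
    P (q ^- (j + r + 2 * d)) d * P (q ^- M) j / P (q ^- (j + r + 2 * d)) j.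
  apply: (mulfI nxj); rewrite [RHS]mulrC divfK //.
  have -> : q ^- (2 * (r + d)) * q ^+ r = q ^- (j + r + 2 * d) * q ^+ j.
    rewrite (_ : (2 * (r + d) = r + (r + 2 * d))%N); last by lia.
    by rewrite -addnA !(exprD _ j) !(exprD _ r); field; nz.
  have -> : q ^- M = q ^- (j + r + 2 * d) * q ^+ d.
    rewrite (_ : (j + r + 2 * d = M + d)%N); last by rewrite /M; lia.
    by rewrite exprD; field; nz.
  by rewrite -!qpochD (addnC d j).
have -> : P (q ^- M) j = qsign (r + d) / (qsign M * q ^+ j) * (P q M / P q (r + d)).
  have eM : M = (r + d + j)%N by rewrite /M; lia.
  by rewrite eM qpoch_expVq -?eM //.
have -> : P (q ^- K) j = qsign r / (qsign K * q ^+ j) * (P q K / P q r).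
  have eK : K = (r + j)%N by rewrite /K; lia.
  by rewrite eK qpoch_expVq -?eK //.
have -> : P (- q ^- M) K = P (- q ^- M) j * P (- q ^- (r + d)) r.
  rewrite /K qpochD; congr (_ * qpoch _ _ _).
  by rewrite /M -addnA (exprD q j) ; field; nz.
rewrite (qpochD q u j r) (qpochD q v j r) /qbinomial addKn addKn.
have -> : (q ^+ m * (q ^+ K / q ^+ M)) ^+ j = (q ^+ m) ^+ j / q ^+ (d * j).
  rewrite exprMn; congr (_ * _); rewrite /M (exprD q K) exprM -exprVn.
  by congr (_ ^+ _); field; nz.
have -> : qsign M = qsign (r + d) * qsign j * q ^+ (r * j) * q ^+ (d * j).
  rewrite -mulrA -exprD -mulnDl -qsignD; congr qsign; rewrite /M; lia.
have -> : qsign K = qsign r * qsign j * q ^+ (r * j).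
  by rewrite -qsignD; congr qsign; rewrite /K; lia.
rewrite /g; field; nz.
Qed.


(** Reversing (q^(K-M); q)_m trades (q; q)_(M-K) for (q; q)_(n-K): up to a constant free of K, a
    coefficient of a series of length M becomes one of a series of length n. *)
Lemma reduction_coef K d m c : let n := (K + d)%N in let M := (m + n)%N in
    P q (2 * M) != 0 ->
  qbin M K * qsign (d + m) * (P (c * q ^+ K) (d + m) * P (- (c * q ^+ K)) (d + m)
    * P (q ^+ K / q ^+ (2 * M)) (d + m))
  * (P (q ^- (2 * M)) m * P (q ^+ K / q ^+ M) m
     / (P (q ^+ K / q ^+ (2 * M)) m * P (q ^- M) m)) =
  P (c * q ^+ n) m * P (- (c * q ^+ n)) m
  * (P (q ^- (2 * M)) m * qsign M / qsign n)
  * (qbin n K * qsign d * (P (c * q ^+ K) d * P (- (c * q ^+ K)) d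
     * P (q ^+ m / q ^+ (2 * M) * q ^+ K) d)).
Proof.
move=> n M nz.
have nzM : P q M != 0 by apply: qpoch_neq0_leq nz; rewrite leq_pmull.
have nzn : P q n != 0 by apply: qpoch_neq0_leq nzM; rewrite leq_addl.
have nzK : P q K != 0 by apply: qpoch_neq0_leq nzn; rewrite leq_addr.
have nzd : P q d != 0 by apply: qpoch_neq0_leq nzn; rewrite leq_addl.
have eM : M = (n + m)%N by rewrite /M addnC.
have eMK : (M - K = d + m)%N by rewrite eM /n -addnA addKn.
have nzdm : P q (d + m) != 0 by rewrite -eMK; apply: qpoch_sub_neq0.
have nzx : P (q ^+ K / q ^+ (2 * M)) m != 0.
  have -> : q ^+ K / q ^+ (2 * M) = q ^- (2 * M - K).
    rewrite (_ : q ^+ (2 * M) = q ^+ (2 * M - K) * q ^+ K).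
      by field; nz.
    by rewrite -exprD subnK // /M /n; clear; lia.
  apply: qpoch_expVq_neq0; last exact: qpoch_sub_neq0.
  by rewrite /M /n; clear; lia.
have -> : P (q ^- M) m = qsign n / (qsign M * q ^+ m) * (P q M / P q n).
  by rewrite eM qpoch_expVq // -eM.
have -> : P (q ^+ K / q ^+ M) m =
    qsign d / (qsign (d + m) * q ^+ m) * (P q (d + m) / P q d).
  rewrite -qpoch_expVq //; congr qpoch.
  by rewrite eM /n -addnA (exprD q K); field; nz.
rewrite [P (q ^+ K / _) (d + m)](_ : _ =
    P (q ^+ K / q ^+ (2 * M)) m * P (q ^+ m / q ^+ (2 * M) * q ^+ K) d); last first.
  by rewrite addnC qpochD; congr (_ * qpoch _ _ _); ring.
rewrite (qpochD q (c * _) d m) (qpochD q (- _) d m) mulNr -(mulrA c) -exprD -/n.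
rewrite /qbinomial eMK /n addKn -/n.
field; nz.
Qed.

(** For fixed K the sum over j is [vwp_sum] with b = q^(-K), w = q^(K-M). The product b w = q^(-M)
    is free of K, so the weight can be a coefficient of the j-th series. The value contains
    (q^(K-M); q)_m, which vanishes for n < K <= M and cuts the length from M to n. *)
Lemma phi_reduction n m u v c : let M := (m + n)%N in
    P q (2 * M) != 0 ->
  \sum_(j < m.+1) vwp (q ^- M) j
     * (P (q ^- m) j / (P q j * P (q ^+ m / q ^+ (2 * M)) j))
     * (P (- q ^- M) j * (P u j * P v j) * (q ^+ m) ^+ j)
     * cleared_phi q (M - j) (- q ^- (M - j)) (u * q ^+ j) (v * q ^+ j)
         (c * q ^+ j) (- (c * q ^+ j)) (q ^- (2 * (M - j))) =
  P (c * q ^+ n) m * P (- (c * q ^+ n)) m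
  * (P (q ^- (2 * M)) m * qsign M / qsign n)
  * cleared_phi q n (- q ^- M) u v c (- c) (q ^+ m / q ^+ (2 * M)).
Proof.
move=> M nz.
have nzM : P q M != 0 by apply: qpoch_neq0_leq nz; rewrite leq_pmull.
have le_mM : (m <= M)%N by apply: leq_addr.
have le_nM : (n <= M)%N by apply: leq_addl.
pose D j := vwp (q ^- M) j
     * (P (q ^- m) j / (P q j * P (q ^+ m / q ^+ (2 * M)) j)).
have D0 j : (m < j)%N -> D j = 0.
  by move=> lt_mj; rewrite /D qpoch_expVq_eq0 // mul0r mulr0.
pose f K j := D j * (P (- q ^- M) j * (P u j * P v j) * (q ^+ m) ^+ j
  * (qbin (M - j) (K - j) * qsign (M - j - (K - j))
     * (P (- q ^- (M - j)) (K - j) * P (u * q ^+ j) (K - j) * P (v * q ^+ j) (K - j))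
     * (P (c * q ^+ j * q ^+ (K - j)) (M - j - (K - j))
        * P (- (c * q ^+ j) * q ^+ (K - j)) (M - j - (K - j))
        * P (q ^- (2 * (M - j)) * q ^+ (K - j)) (M - j - (K - j))))).
(* Since (q^(-m); q)_j vanishes for j > m, j may run up to M; the pairs (j, r) then fill a
   triangle. *)
rewrite -(@sum_ord_trunc (fun j => D j * (P (- q ^- M) j * (P u j * P v j) * (q ^+ m) ^+ j)
     * cleared_phi q (M - j) (- q ^- (M - j)) (u * q ^+ j) (v * q ^+ j)
         (c * q ^+ j) (- (c * q ^+ j)) (q ^- (2 * (M - j)))) _ M) //; last first.
  by move=> j /andP[lt_mj _]; rewrite D0 // !mul0r.
transitivity (\sum_(K < M.+1) \sum_(j < K.+1) f K j).
  rewrite sum_triangle; apply: eq_bigr => -[j /= lt_jM] _.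
  rewrite mulr_sumr; apply: eq_bigr => -[r /= lt_rM] _.
  by rewrite /f addKn !mulrA.
pose G K := qbin M K * qsign (M - K) * (P (- q ^- M) K * P u K * P v K)
  * (P (c * q ^+ K) (M - K) * P (- (c * q ^+ K)) (M - K)
     * P (q ^+ K / q ^+ (2 * M)) (M - K)).
have fE K j : (j <= K <= M)%N ->
    f K j = G K * (vwp (q ^- M) j * vwp_tail m (q ^- K) (q ^+ K / q ^+ M) j).
  case/andP=> le_jK le_KM.
  have [r eK] : exists r, K = (j + r)%N by exists (K - j)%N; rewrite subnKC.
  have [d edM] : exists d, M = (j + r + d)%N.
    by exists (M - K)%N; rewrite -eK subnKC.
  have := @reduction_term j r d m u v c; rewrite -edM -eK => /(_ nz) /= E.
  have eN : (M - j = r + d)%N by rewrite edM -addnA addKn.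
  have eMK : (M - K = d)%N by rewrite edM eK addKn.
  have eKj : (K - j = r)%N by rewrite eK addKn.
  rewrite /f eKj eN addKn mulNr -(mulrA c) -exprD -eK E /G eMK.
  rewrite /D /vwp_factor.
  have -> : q ^- K * (q ^+ K / q ^+ M) ^+ 2 = q ^+ K / q ^+ (2 * M).
    by rewrite mulnC exprM; field; nz.
  have -> : (q ^- K * (q ^+ K / q ^+ M)) ^+ 2 * q ^+ m = q ^+ m / q ^+ (2 * M).
    by rewrite mulnC exprM; field; nz.
  by rewrite !invfM; ring.
have sumE K : (K <= M)%N ->
    \sum_(j < K.+1) f K j =
    G K * (P (q ^- (2 * M)) m * P (q ^+ K / q ^+ M) m
     / (P (q ^+ K / q ^+ (2 * M)) m * P (q ^- M) m)).
  move=> le_KM.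
  pose t j := vwp (q ^- M) j * vwp_tail m (q ^- K) (q ^+ K / q ^+ M) j.
  transitivity (G K * \sum_(j < K.+1) t j).
    rewrite mulr_sumr; apply: eq_bigr => -[j /= lt_jK] _.
    by apply: fE; rewrite -ltnS lt_jK le_KM.
  (* The range j <= K is exchanged for j <= m by way of M: (q^(-K); q)_j vanishes beyond K, and
     (q^(-m); q)_j beyond m. *)
  congr (_ * _); rewrite -(@sum_ord_trunc t _ M) //; last first.
    move=> j /andP[lt_Kj _]; rewrite /t /vwp_factor qpoch_expVq_eq0 //.
    by rewrite !mul0r mulr0.
  rewrite (@sum_ord_trunc t m) //; last first.
    move=> j /andP[lt_mj _]; rewrite /t /vwp_factor (@qpoch_expVq_eq0 m j) //.
    by rewrite mulr0 !mul0r mulr0.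
  have e1 : q ^- K * (q ^+ K / q ^+ M) = q ^- M by field; nz.
  have e2 : q ^- K * (q ^+ K / q ^+ M) ^+ 2 = q ^+ K / q ^+ (2 * M).
    by rewrite mulnC exprM; field; nz.
  have e3 : q ^- M ^+ 2 = q ^- (2 * M) by rewrite mulnC exprM exprVn.
  have := @vwp_sum _ q q_neq0 m (q ^- K) (q ^+ K / q ^+ M).
  rewrite e2 e1 e3; apply.
  - exact: qpoch_neq0_leq nzM.
  - by apply: qpoch_expVq_neq0; rewrite // leq_mul2l.
  - have -> : q ^+ K / q ^+ (2 * M) = q ^- (2 * M - K).
      rewrite (_ : q ^+ (2 * M) = q ^+ (2 * M - K) * q ^+ K).
        by field; nz.
      by rewrite -exprD subnK // (leq_trans le_KM) // leq_pmull.
    apply: qpoch_expVq_neq0; last exact: qpoch_sub_neq0.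
    by rewrite mul2n -addnn -addnBA // (leq_trans le_mM) // leq_addr.
  exact: qpoch_expVq_neq0.
rewrite (eq_bigr (fun K : 'I_M.+1 => G K * (P (q ^- (2 * M)) m * P (q ^+ K / q ^+ M) m
     / (P (q ^+ K / q ^+ (2 * M)) m * P (q ^- M) m)))); last first.
  by move=> [K /= lt_KM] _; apply: sumE.
rewrite (@sum_ord_trunc (fun K => G K * (P (q ^- (2 * M)) m * P (q ^+ K / q ^+ M) m
     / (P (q ^+ K / q ^+ (2 * M)) m * P (q ^- M) m))) n) //; last first.
  move=> K /andP[lt_nK le_KM].
  have -> : P (q ^+ K / q ^+ M) m = 0.
    apply: (@qpoch_factor_eq0 _ q _ m (M - K)); first by rewrite /M; lia.
    by rewrite mulrAC -exprD subnKC // divff // expf_neq0.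
  by rewrite mulr0 mul0r mulr0.
rewrite mulr_sumr; apply: eq_bigr => -[K /= lt_Kn] _; rewrite ltnS in lt_Kn.
have [d en] : exists d, n = (K + d)%N by exists (n - K)%N; rewrite subnKC.
have := @reduction_coef K d m c; rewrite -en -/M => /(_ nz) /= E.
have eMK : (M - K = d + m)%N by rewrite /M en; clear; lia.
have enK : (n - K = d)%N by rewrite en addKn.
rewrite /G eMK enK mulNr.
transitivity (P (- q ^- M) K * P u K * P v K 
  * (qbin M K * qsign (d + m) * (P (c * q ^+ K) (d + m) * P (- (c * q ^+ K)) (d + m)
    * P (q ^+ K / q ^+ (2 * M)) (d + m))
  * (P (q ^- (2 * M)) m * P (q ^+ K / q ^+ M) m
     / (P (q ^+ K / q ^+ (2 * M)) m * P (q ^- M) m)))); first by ring.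
by rewrite E; ring.
Qed.

End Reduction.

(** * Linearization: the sum over i, and the scalar factors of the double sum *)

Section Assembly.
Variables (F : fieldType) (q : F).
Hypothesis q_neq0 : q != 0.

Local Notation P x n := (qpoch x q n).
Local Notation qsign := (qsign q).
Local Notation vwp := (vwp_weight q).
Local Notation vwp_tail := (vwp_factor q).

Lemma cleared_phi_rot n A B C D E G :
  cleared_phi q n A B C D E G = cleared_phi q n A B C G D E.
Proof. by apply: eq_bigr => k _; ring. Qed.

Lemma qhyper_cleared n A B C D E G :
    P q n != 0 -> P D n != 0 -> P E n != 0 -> P G n != 0 ->
  qhyper n [:: B; C; q ^- n; A] [:: E; G; D] q q =
  cleared_phi q n A B C D E G / (qsign n * (P D n * P E n * P G n)).
Proof.
move=> nz nzD nzE nzG; rewrite /cleared_phi mulr_suml.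
apply: eq_bigr => -[k /= lt_kn] _; rewrite !qpochsE ltnS in lt_kn *.
have [d en] : exists d, n = (k + d)%N by exists (n - k)%N; rewrite subnKC.
move: nz nzD nzE nzG; rewrite en addKn !(addnC k d) => nz nzD nzE nzG.
have nzk : P q k != 0 by apply: qpoch_neq0_leq nz; rewrite leq_addl.
have nzd : P q d != 0 by apply: qpoch_neq0_leq nz; rewrite leq_addr.
rewrite qpoch_expVq // /qbinomial addnK.
move: nzD nzE nzG; rewrite (addnC d k) !qpochD !mulf_eq0 !negb_or.
move=> /andP[D1 D2] /andP[E1 E2] /andP[G1 G2].
have qs := qsign_neq0 q_neq0 (k + d).
by field; nz.
Qed.

(** Termwise [vwp_sum_reciprocal_pair], with y = b w: the pair y, q^(1-l)/y over the lower parameter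
    q^(1-l)/w is a combination of pairs y q^i, q^(1-i)/y of product q over q/w, with coefficients
    free of the index k. *)
Lemma phi_linearization n l A D E b w :
    b != 0 -> w != 0 -> P q l != 0 -> P ((b * w) ^+ 2) (2 * l) != 0 ->
    P (b * w ^+ 2) l != 0 -> P (b * w) l != 0 -> P (q / (w * q ^+ l)) n != 0 ->
  P ((b * w) ^+ 2) l * P w l / (P (b * w ^+ 2) l * P (b * w) l)
  * P (q / w) n
  * cleared_phi q n A (b * w) (q / (b * w * q ^+ l)) D E (q / (w * q ^+ l)) =
  P (q / (w * q ^+ l)) n * \sum_(i < l.+1) vwp (b * w) i * vwp_tail l b w i
    * cleared_phi q n A (b * w * q ^+ i) (q / (b * w * q ^+ i)) D E (q / w).
Proof.
move=> b0 w0 nzq nzy2 nzbw2 nzy nz.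
under eq_bigr do rewrite /cleared_phi mulr_sumr.
rewrite exchange_big /= /cleared_phi !mulr_sumr.
apply: eq_bigr => -[k /= lt_kn] _; rewrite ltnS in lt_kn.
have nzk : P (q / (w * q ^+ l)) k != 0 by apply: qpoch_neq0_leq nz.
have split_n x : P x n = P x k * P (x * q ^+ k) (n - k).
  by rewrite -qpochD subnKC.
have := vwp_sum_reciprocal_pair q_neq0 b0 w0 nzq nzy2 nzbw2 nzy nzk.
set Cst := _ / _ => B.
transitivity (P (q / (w * q ^+ l)) n * (qbinomial q n k * qsign (n - k) * P A k
    * (P (D * q ^+ k) (n - k) * P (E * q ^+ k) (n - k) * P (q / w * q ^+ k) (n - k)))
  * \sum_(i < l.+1) vwp (b * w) i * vwp_tail l b w i
    * (P (b * w * q ^+ i) k * P (q / (b * w * q ^+ i)) k)).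
  by rewrite B !split_n; clearbody Cst; field.
by rewrite -mulrA !mulr_sumr; apply: eq_bigr => i _; ring.
Qed.

Lemma vwpE y i : 1 - y ^+ 2 / q != 0 ->
  (1 - y ^+ 2 / q * q ^+ (2 * i)) / (1 - y ^+ 2 / q) * P (y ^+ 2 / q) i = vwp y i.
Proof.
case: i => [|i] nz; first by rewrite qpoch0 muln0 !mulr1 divff.
rewrite qpochSl /vwp_weight (_ : (2 * i.+1 = (2 * i).+2)%N); last by rewrite mulnS.
have -> : y ^+ 2 / q * q = y ^+ 2 by field.
have -> : y ^+ 2 / q * q ^+ (2 * i).+2 = y ^+ 2 * q ^+ (2 * i).+1.
  by rewrite !(exprS q (2 * i).+1); field.
by move: nz; set u := 1 - _ / q => nz; field.
Qed.

(** The weight is (A q; q)_(2i), with A = y^2/q, without its factors from A q^i to A q^(2i-1). For y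
    = q^(-m-n) these make up the denominator (q^(j-2m-2n-1); q)_j of [Tterm]. *)
Lemma vwp_double y i : y ^+ 2 / q != 0 -> P (y ^+ 2 / q * q ^+ i) i != 0 ->
  vwp y i = P (y ^+ 2) (2 * i) / P (y ^+ 2 / q * q ^+ i) i.
Proof.
move=> y0 nz; apply: (mulIf nz); rewrite divfK //.
case: i {nz} => [|i]; first by rewrite !qpoch0 mulr1.
rewrite /vwp_weight (_ : (2 * i.+1 = i + i.+2)%N); last by rewrite mul2n -addnn addSn -addnS.
rewrite (qpochD q _ i).
have -> : y ^+ 2 / q * q ^+ i.+1 = y ^+ 2 * q ^+ i by rewrite (exprS q i); field.
rewrite (qpochS _ _ i.+1) (_ : q ^+ (2 * i).+1 = q ^+ i * q ^+ i.+1); last first.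
  by rewrite -exprD addnS mul2n addnn.
by ring.
Qed.

(** The part of [term_scalar] free of c, where the power of q and the sign attached to j in [Tterm]
    arise. Reversal turns all factorials at negative powers of q into (q; q)'s, and (q; q)_(2N) =
    (q; q^2)_N (q, -q; q)_N cancels the rest. *)
Lemma term_q_scalar m n N j : let M := (N + j)%N in M = (m + n)%N -> (j <= m)%N ->
    P q (2 * M) != 0 ->
  q ^+ (M.+1 * n) / (P (q ^- (2 * M)) m * qsign M / qsign n)
  * P (q ^- (2 * M)) (2 * j) * (q ^+ m) ^+ j
  * (P (- q) N / q ^+ (N + N * N)) * qpoch q (q ^+ 2) N =
  P (q ^+ M.+1) n * (q ^+ 'C(j.+1, 2) / q ^+ (n * j) * (-1) ^+ j) * P (q ^- M) j.
Proof.
move=> M eM le_jm nz.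
have nzM : P q M != 0 by apply: qpoch_neq0_leq nz; rewrite leq_pmull.
have nzN : P q N != 0 by apply: qpoch_neq0_leq nzM; rewrite leq_addr.
have nz2N : P q (2 * N) != 0.
  by apply: qpoch_neq0_leq nz; rewrite leq_mul2l leq_addr.
have e2M : (2 * M = M + n + m)%N by rewrite mul2n -addnn {2}eM (addnC m) addnA.
have nzMn : P q (M + n) != 0 by apply: qpoch_neq0_leq nz; rewrite e2M leq_addr.
have -> : P (q ^- (2 * M)) m =
    qsign (M + n) / (qsign (2 * M) * q ^+ m) * (P q (2 * M) / P q (M + n)).
  by rewrite e2M qpoch_expVq // -e2M.
have -> : P (q ^- (2 * M)) (2 * j) =
    qsign (2 * N) / (qsign (2 * M) * q ^+ (2 * j)) * (P q (2 * M) / P q (2 * N)).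
  by rewrite /M mulnDr qpoch_expVq // -mulnDr.
have -> : P (q ^- M) j = qsign N / (qsign M * q ^+ j) * (P q M / P q N).
  by rewrite qpoch_expVq.
have -> : P (q ^+ M.+1) n = P q (M + n) / P q M.
  by rewrite qpochD -exprS; field.
have oe : qpoch q (q ^+ 2) N * (P q N * P (- q) N) = P q (2 * N).
  by rewrite qpoch_odd_even.
transitivity (q ^+ (M.+1 * n) * qsign n * qsign (2 * N) * q ^+ m * (q ^+ m) ^+ j
   / (qsign (M + n) * qsign M * q ^+ (2 * j) * q ^+ (N + N * N))
   * (P q (M + n) / P q N)).
  transitivity (q ^+ (M.+1 * n) * qsign n * qsign (2 * N) * q ^+ m * (q ^+ m) ^+ j
   / (qsign (M + n) * qsign M * q ^+ (2 * j) * q ^+ (N + N * N))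
   * (P q (M + n) / P q N) * (qpoch q (q ^+ 2) N * (P q N * P (- q) N)) / P q (2 * N)).
    by field; nz.
  by rewrite oe mulfK.
have bS : q ^+ 'C(j.+1, 2) * (-1) ^+ j = qsign j * q ^+ j.
  by rewrite qsignE binS bin1 exprD; ring.
transitivity (qsign j * q ^+ j / q ^+ (n * j) * (qsign N / (qsign M * q ^+ j))
   * (P q (M + n) / P q N)); last first.
  by rewrite -bS; field; nz.
congr (_ * _).
have -> : qsign (2 * N) = qsign N * qsign N * q ^+ (N * N).
  by rewrite mul2n -addnn qsignD.
have -> : qsign (M + n) = qsign M * qsign n * q ^+ (M * n) by rewrite qsignD.
have -> : qsign M = qsign N * qsign j * q ^+ (N * j) by rewrite qsignD.
have -> : q ^+ (M.+1 * n) = q ^+ n * q ^+ (M * n) by rewrite mulSn exprD.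
(* Both exponents of q are (j+1)M - nj, since M = m + n = N + j. *)
have sq : q ^+ n * q ^+ m * (q ^+ m) ^+ j =
    qsign j ^+ 2 * q ^+ j * q ^+ j * q ^+ (N * j) * q ^+ N / q ^+ (n * j).
  apply: (mulIf (expq_neq0 q_neq0 (n * j))); rewrite divfK ?expq_neq0 //.
  rewrite sqr_qsign -exprM -!exprD -addnA -mulnDl (addnC n m) -eM /M.
  by congr (_ ^+ _); ring.
transitivity (q ^+ n * q ^+ m * (q ^+ m) ^+ j
   / (qsign j ^+ 2 * q ^+ (N * j) ^+ 2 * q ^+ (2 * j) * q ^+ N)).
  by rewrite (exprD q N (N * N)); field; nz.
rewrite sq mul2n -addnn (exprD q j j); field; nz.
Qed.

(** Gathers the factors of the (i, j) term that involve neither a nor i: both Sears prefactors, the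
    normalization of the 4phi3, the constant of [phi_reduction], the weight in j and the prefactor
    of [watson]. *)
Lemma term_scalar c l m n j : let M := (m + n)%N in let N := (M - j)%N in
    (j <= m)%N -> c != 0 -> P q (2 * M) != 0 -> P (- q) M != 0 ->
    P (q ^+ j / q ^+ (2 * M).+1) j != 0 -> P c M != 0 -> P (- c) M != 0 ->
    P (q ^+ M / q ^+ l * c) n != 0 ->
  (- q ^+ l) ^+ n * (- q / c) ^+ n
  / (qsign n * (P (q ^+ l.+1 / (q ^+ (m + 2 * n) * c)) n * P c n * P (- c) n))
  / (P (c * q ^+ n) m * P (- (c * q ^+ n)) m
     * (P (q ^- (2 * M)) m * qsign M / qsign n))
  * (vwp (q ^- M) j * (P (q ^- m) j / (P q j * P (q ^+ m / q ^+ (2 * M)) j))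
     * (q ^+ m) ^+ j) * (P (- q) N / q ^+ (N + N * N)) =
  P (q ^+ M.+1) n / P (q ^+ M / q ^+ l * c) n
  * (q ^+ 'C(j.+1, 2) / q ^+ (n * j) * (-1) ^+ j)
  * (P (q ^- m) j * P (q ^- M) j
     / (P q j * P c j * P (- c) j * P (q ^+ m / q ^+ (2 * M)) j
        * P (q ^+ j / q ^+ (2 * M).+1) j))
  / (qpoch q (q ^+ 2) N * qpoch (q ^+ (2 * j) * c ^+ 2) (q ^+ 2) N).
Proof.
move=> M N le_jm c0 nz nzN nzj nzc nzNc nzF.
have l0 := expq_neq0 q_neq0 l; have M0 := expq_neq0 q_neq0 M.
have eM : M = (N + j)%N by rewrite subnK // (leq_trans le_jm) ?leq_addr.
have nzM : P q M != 0 by apply: qpoch_neq0_leq nz; rewrite leq_pmull.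
have nzq2 : qpoch q (q ^+ 2) N != 0.
  have : P q (2 * N) != 0 by apply: qpoch_neq0_leq nz; rewrite leq_mul2l leq_subr.
  by rewrite qpoch_odd_even mulf_eq0 negb_or => /andP[].
have := @term_q_scalar m n N j; rewrite -eM => /(_ erefl le_jm nz) Q.
have -> : P (q ^+ l.+1 / (q ^+ (m + 2 * n) * c)) n =
    P (q ^+ M / q ^+ l * c) n / ((q ^+ M / q ^+ l * c) ^+ n * qsign n).
  rewrite -qpoch_rev //; last by nz.
  congr qpoch; rewrite (_ : (m + 2 * n = n + M)%N).
    by rewrite (exprD q n M) (exprS q l); field; nz.
  by rewrite mul2n -addnn addnCA addnA.
(* The two Sears prefactors meet the power released by reversing (q^(1+l-m-2n)/c; q)_n, and l and c
   drop out. *)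
have eA : (- q ^+ l) ^+ n * (- q / c) ^+ n * (q ^+ M / q ^+ l * c) ^+ n =
    q ^+ (M.+1 * n).
  by rewrite exprM -!exprMn (exprS q M); congr (_ ^+ _); field; nz.
have ec x : P x n * P (x * q ^+ n) m = P x j * P (x * q ^+ j) N.
  by rewrite -!qpochD (addnC n) (addnC j) -eM.
have ec1 := ec c; have ec2 := ec (- c); rewrite !mulNr in ec2.
have nzjN x : P x M != 0 -> [/\ P x n != 0, P (x * q ^+ n) m != 0,
   P x j != 0 & P (x * q ^+ j) N != 0].
  move=> nzx; have : P x j * P (x * q ^+ j) N != 0.
    by rewrite -qpochD (addnC j) -eM.
  rewrite mulf_eq0 negb_or => /andP[-> ->].
  have : P x n * P (x * q ^+ n) m != 0 by rewrite -qpochD (addnC n).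
  by rewrite mulf_eq0 negb_or => /andP[-> ->].
have [c1 c2 c3 c4] := nzjN c nzc.
have [d1 d2 d3 d4] := nzjN (- c) nzNc; rewrite !mulNr in d2 d4.
have e2c : qpoch (q ^+ (2 * j) * c ^+ 2) (q ^+ 2) N =
    P (c * q ^+ j) N * P (- (c * q ^+ j)) N.
  by rewrite qpoch_mulN mulnC exprM -exprMn (mulrC c).
have evw : vwp (q ^- M) j = P (q ^- (2 * M)) (2 * j) / P (q ^+ j / q ^+ (2 * M).+1) j.
  have e : (q ^- M) ^+ 2 = q ^- (2 * M) by rewrite mulnC exprM exprVn.
  have e' : q ^- (2 * M) / q * q ^+ j = q ^+ j / q ^+ (2 * M).+1.
    by rewrite exprS; field; nz.
  by rewrite vwp_double e ?e' //; nz.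
rewrite evw e2c.
set S := P (q ^- (2 * M)) m * qsign M / qsign n in Q *.
have S0 : S != 0.
  have nzS : P (q ^- (2 * M)) m != 0.
    by apply: qpoch_expVq_neq0 => //; rewrite /M; clear; lia.
  by rewrite /S; nz.
have nzx : P (q ^+ m / q ^+ (2 * M)) j != 0.
  have -> : q ^+ m / q ^+ (2 * M) = q ^- (2 * M - m).
    have e : q ^+ (2 * M) = q ^+ (2 * M - m) * q ^+ m.
      by rewrite -exprD subnK // /M; clear; lia.
    by rewrite e; field; nz.
  apply: qpoch_expVq_neq0 => //; last exact: qpoch_sub_neq0.
  by move: le_jm; rewrite /M; clear; lia.
have nzqj : P q j != 0 by apply: qpoch_neq0_leq nzM; rewrite eM leq_addl.
transitivity (q ^+ (M.+1 * n) / S * P (q ^- (2 * M)) (2 * j) * q ^+ m ^+ j *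
     (P (- q) N / q ^+ (N + N * N)) * qpoch q (q ^+ 2) N
  * (P (q ^- m) j / (P q j * P (q ^+ m / q ^+ (2 * M)) j
     * P (q ^+ j / q ^+ (2 * M).+1) j * P (q ^+ M / q ^+ l * c) n
     * qpoch q (q ^+ 2) N * (P c n * P (c * q ^+ n) m)
     * (P (- c) n * P (- (c * q ^+ n)) m)))).
  by rewrite -eA; clear Q; clearbody S; field; nz.
by rewrite Q ec1 ec2; clear Q; clearbody S; field; nz.
Qed.

End Assembly.

(** * The transformation over an arbitrary field *)

Section Transformation.
Variables (F : fieldType) (q : F).
Hypothesis q_neq0 : q != 0.

Local Notation P x n := (qpoch x q n).
Local Notation qsign := (qsign q).
Local Notation vwp := (vwp_weight q).
Local Notation vwp_tail := (vwp_factor q).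

Lemma exprz_subn (z : int) a b : z = a%:Z - b%:Z -> q ^ z = q ^+ a / q ^+ b.
Proof. by move=> ->; rewrite expfzDr // -exprnN. Qed.

Lemma qpoch_sqr_base_neq0 x n : P x (2 * n) != 0 -> qpoch x (q ^+ 2) n != 0.
Proof.
move=> nz; apply/prodf_neq0 => k _; rewrite -exprM.
by apply: (qpoch_factor_neq0 nz); rewrite ltn_mul2l ltn_ord.
Qed.

(** Separates the coefficient of the sum over i, a scalar as in [term_scalar], and the factors in u
    = a c/q^(1+i) and v = q^i c/a that come from the shifted series and [watson]. *)
Lemma TtermE a c l m n i j : let M := (m + n)%N in
    a != 0 -> c != 0 -> 1 - q / a ^+ 2 != 0 ->
  Tterm q a c l m n i j =
  vwp (c / a * (- q / c)) i * vwp_tail l (c / a) (- q / c) i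
  * ((q ^+ 'C(j.+1, 2) / q ^+ (n * j) * (-1) ^+ j)
  * (P (q ^- m) j * P (q ^- M) j
     / (P q j * P c j * P (- c) j * P (q ^+ m / q ^+ (2 * M)) j
        * P (q ^+ j / q ^+ (2 * M).+1) j))
  / (qpoch q (q ^+ 2) (M - j) * qpoch (q ^+ (2 * j) * c ^+ 2) (q ^+ 2) (M - j)))
  * (P (- q ^- M) j * (P (a * c / (q * q ^+ i)) j * P (q ^+ i * c / a) j)
     * (qpoch (q * (a * c / (q * q ^+ i) * q ^+ j)) (q ^+ 2) (M - j)
        * qpoch (q * (q ^+ i * c / a * q ^+ j)) (q ^+ 2) (M - j))).
Proof.
move=> M a0 c0 nz.
have i0 := expq_neq0 q_neq0 i.
rewrite /Tterm !qpochsE.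
rewrite (@exprz_subn _ (l.+1 * i + 'C(j.+1, 2)) (n * j)); last by lia.
rewrite (@exprz_subn (- l%:Z) 0 l) ?sub0r // (@exprz_subn (- m%:Z) 0 m) ?sub0r //.
rewrite (@exprz_subn (- m%:Z - n%:Z) 0 M); last by rewrite /M; clear; lia.
rewrite (@exprz_subn (- i%:Z - 1) 0 i.+1); last by lia.
rewrite (@exprz_subn (- m%:Z - 2 * n%:Z) m (2 * M)); last by rewrite /M; clear; lia.
rewrite (@exprz_subn (j%:Z - 2 * m%:Z - 2 * n%:Z - 1) j (2 * M).+1); last by rewrite /M; clear; lia.
rewrite (@exprz_subn (j%:Z - i%:Z) j i) // !mul1r -/M.
have y2 : (c / a * (- q / c)) ^+ 2 = q ^+ 2 / a ^+ 2 by field; nz.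
have y2q : q ^+ 2 / a ^+ 2 / q = q / a ^+ 2 by field; nz.
have bw2 : c / a * (- q / c) ^+ 2 = q ^+ 2 / (a * c) by field; nz.
move: y2 bw2; rewrite /vwp_factor.
set y := c / a * (- q / c) => y2 bw2.
have <- : (1 - q / a ^+ 2 * q ^+ (2 * i)) / (1 - q / a ^+ 2) * P (q / a ^+ 2) i
    = vwp y i.
  by rewrite -vwpE ?y2 ?y2q.
rewrite y2 bw2.
have -> : q ^- i.+1 * a * c = a * c / (q * q ^+ i) by rewrite exprS; field; nz.
have -> : q ^+ j / q ^+ i * a * c = q * (a * c / (q * q ^+ i) * q ^+ j).
  by field; nz.
have -> : q ^+ (1 + i + j) * c / a = q * (q ^+ i * c / a * q ^+ j).
  by rewrite -addnA addnC addn1 exprS exprD; field; nz.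
have -> : q ^+ (2 + l) / a ^+ 2 = q ^+ 2 / a ^+ 2 * q ^+ l.
  by rewrite exprD; field; nz.
have -> : q ^+ (1 + 2 * i) / a ^+ 2 = q / a ^+ 2 * q ^+ (2 * i).
  by rewrite add1n (exprS q (2 * i)); field; nz.
have -> : (q ^+ l * (- q / c)) ^+ i = q ^+ (l.+1 * i) * ((-1) ^+ i / c ^+ i).
  rewrite exprM exprSr -expr_div_n -exprMn; congr (_ ^+ _); field; nz.
rewrite (exprD q (l.+1 * i)) (exprD (-1)) !invfM; ring.
Qed.


Lemma transformation_4phi3 a c l m n (ha : a != 0) (hc : c != 0)
  (hphi : forall k : nat, (k <= n)%N ->
     qpochs [:: q; c; q ^ (1 + l%:Z - m%:Z - 2 * n%:Z) / c; - q] q k != 0)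
  (hpre1 : qpochs [:: q ^+ 2 / a ^+ 2; - q / c] q l != 0)
  (hpre2 : qpochs [:: q ^ (n%:Z + m%:Z - l%:Z) * c; - q] q n != 0)
  (hT0 : 1 - q / a ^+ 2 != 0)
  (hT1 : forall i : nat, (i <= l)%N ->
     qpochs [:: q; q ^+ 2 / (a * c); q ^+ (2 + l) / a ^+ 2] q i != 0)
  (hT2 : forall j : nat, (j <= m)%N ->
     qpochs [:: q; c; - c; q ^ (- m%:Z - 2 * n%:Z);
                q ^ (j%:Z - 2 * m%:Z - 2 * n%:Z - 1)] q j != 0)
  (hT3 : forall j : nat, (j <= m)%N ->
     qpochs [:: q; q ^+ (2 * j) * c ^+ 2] (q ^+ 2) (m + n - j) != 0) :
  qhyper n
    [:: a; q ^+ (1 + l) / a; q ^ (- n%:Z); - q ^ (- m%:Z - n%:Z)]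
    [:: c; q ^ (1 + l%:Z - m%:Z - 2 * n%:Z) / c; - q] q q
  = qpochs [:: q ^+ 2 / (a * c); - q / a] q l
    / qpochs [:: q ^+ 2 / a ^+ 2; - q / c] q l
    * (qpochs [:: q ^+ (1 + m + n); - q ^ (- l%:Z) * c] q n
       / qpochs [:: q ^ (n%:Z + m%:Z - l%:Z) * c; - q] q n)
    * \sum_(i < l.+1) \sum_(j < m.+1) Tterm q a c l m n i j.
Proof.
pose M := (m + n)%N.
have l0 := expq_neq0 q_neq0 l; have M0 := expq_neq0 q_neq0 M.
have n0 := expq_neq0 q_neq0 n.
move: (hphi n (leqnn n)) hpre1 hpre2 (hT1 l (leqnn l)) (hT3 0%N (leq0n m)).
rewrite (@exprz_subn (1 + l%:Z - m%:Z - 2 * n%:Z) l.+1 (m + 2 * n)); last by clear; lia.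
rewrite (@exprz_subn (- n%:Z) 0 n) ?sub0r // (@exprz_subn (- l%:Z) 0 l) ?sub0r //.
rewrite (@exprz_subn (- m%:Z - n%:Z) 0 M); last by rewrite /M; clear; lia.
rewrite (@exprz_subn (n%:Z + m%:Z - l%:Z) M l); last by rewrite /M; clear; lia.
rewrite !mul1r !qpochsE !mulf_eq0 !negb_or subn0 -/M ?muln0 ?mul1r.
move=> /and4P[nzq nzc nzF nzN] /andP[nza2 nzw] /andP[nzH _].
move=> /and3P[nzql nzac nza2l] /andP[nzqodd nzc2].
have [nzcM nzNcM] : P c M != 0 /\ P (- c) M != 0.
  by move: nzc2; rewrite -qpoch_mulN mulf_eq0 negb_or => /andP[].
(* For t < n the factor 1 - q^(2t+2) divides (q, -q; q)_n. For n <= t < M take j = M - t: the last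
   factor of (q^(j-2M-1); q)_j is 1 - q^(-2t-2). With (q; q^2)_M from [hT3] at j = 0, this gives (q;
   q)_(2M) != 0. *)
have nzeven : qpoch (q ^+ 2) (q ^+ 2) M != 0.
  apply/prodf_neq0 => -[t /= lt_tM] _.
  have [lt_tn|le_nt] := ltnP t n.
    have : qpoch (q ^+ 2) (q ^+ 2) n != 0 by rewrite -qpoch_mulN mulf_neq0.
    by move/qpoch_factor_neq0; apply.
  have [j1 ej] : exists j1, (M - t = j1.+1)%N.
    by exists (M - t).-1; rewrite prednK // subn_gt0.
  have le_jm : (j1.+1 <= m)%N by rewrite -ej /M; move: le_nt; clear; lia.
  have := hT2 _ le_jm; rewrite !qpochsE !mulf_eq0 !negb_or => /and5P[_ _ _ _].
  rewrite (@exprz_subn (j1.+1%:Z - 2 * m%:Z - 2 * n%:Z - 1) j1.+1 (2 * M).+1);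
    last by rewrite /M; clear; lia.
  move/qpoch_factor_neq0 => /(_ j1 (ltnSn j1)).
  apply: contraNneq => /eqP; rewrite subr_eq0 => /eqP e1.
  have eM : (2 * M).+2 = (2 * t.+1 + (j1.+1 + j1.+1))%N.
    by move: ej lt_tM; clear; lia.
  have -> : q ^+ j1.+1 / q ^+ (2 * M).+1 * q ^+ j1 = (q ^+ 2 * q ^+ 2 ^+ t)^-1.
    rewrite -exprS -exprM.
    apply: (mulIf (expq_neq0 q_neq0 (2 * M).+2)).
    rewrite {2}eM exprD -mulrA mulKf ?expq_neq0 // (exprS q (2 * M).+1).
    rewrite exprD (exprS q j1); field; nz.
  by rewrite -e1 invr1 subrr.
have nzNM : P (- q) M != 0.
  by move: nzeven; rewrite -qpoch_mulN mulf_eq0 negb_or => /andP[].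
have nzqM : P q M != 0.
  by move: nzeven; rewrite -qpoch_mulN mulf_eq0 negb_or => /andP[].
have nz2M : P q (2 * M) != 0 by rewrite qpoch_odd_even mulf_neq0 // mulf_neq0.
(* Chosen so that b w = -q/a starts the pair made by the first Sears step, and q/(w q^l) = -c q^(-l)
   is what that step makes of the lower parameter c. *)
pose b := c / a; pose w := - q / c.
have b0 : b != 0 by rewrite /b; nz.
have w0 : w != 0 by rewrite /w; nz.
have ey : b * w = - q / a by rewrite /b /w; field; nz.
have ey2 : (b * w) ^+ 2 = q ^+ 2 / a ^+ 2 by rewrite ey; field; nz.
have ebw2 : b * w ^+ 2 = q ^+ 2 / (a * c) by rewrite /b /w; field; nz.
have eqw : q / w = - c by rewrite /w; field; nz.
have eqwl : q / (w * q ^+ l) = - q ^- l * c by rewrite /w; field; nz.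
have nzy2 : P ((b * w) ^+ 2) (2 * l) != 0.
  rewrite ey2 mul2n -addnn qpochD mulf_neq0 //.
  by rewrite mulrAC -exprD.
have nzy : P (b * w) l != 0.
  have := qpoch_sqr_base_neq0 nzy2.
  by rewrite -qpoch_mulN mulf_eq0 negb_or => /andP[].
(* Extended to length l + M this splits into a reversal of (-q/c; q)_l and (-c; q)_M, both
   nonzero. *)
have nzcl : P (- q ^- l * c) n != 0.
  apply: (@qpoch_neq0_leq _ _ _ n (l + M)).
    by rewrite /M addnA leq_addl.
  rewrite qpochD (_ : - q ^- l * c * q ^+ l = - c); last by field; nz.
  rewrite mulf_neq0 // (_ : - q ^- l * c = q / (q ^+ l * w)); last by rewrite -eqwl (mulrC w).
  by rewrite qpoch_rev //; nz.
rewrite add1n in nza2l *.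
have eF : q ^+ l.+1 / q ^+ (m + 2 * n) / c = q ^+ l.+1 / (q ^+ (m + 2 * n) * c).
  by rewrite invfM mulrA.
rewrite eF in nzF *.
rewrite qhyper_cleared //.
pose A := - q ^- M.
have A0 : A != 0 by rewrite /A; nz.
have emn : (m + 2 * n = M + n)%N by rewrite /M mul2n -addnn addnA.
(* In [cleared_sears], Y is the product of the upper pair over the lower parameter Y u v; here
   q^(1+l) over -q. *)
pose Y := - q ^+ l; pose e := - q / (q ^+ (m + 2 * n) * c).
have qmn0 := expq_neq0 q_neq0 (m + 2 * n).
have sears1 : cleared_phi q n A a (q ^+ l.+1 / a) (- q) c
      (q ^+ l.+1 / (q ^+ (m + 2 * n) * c)) =
    Y ^+ n * cleared_phi q n A (b * w) (q / (b * w * q ^+ l)) (- q) e (q / (w * q ^+ l)).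
  have Y0 : Y != 0 by rewrite /Y; nz.
  have g0 : q / (w * q ^+ l) != 0 by nz.
  have bal : e * (q / (w * q ^+ l)) * Y * q ^+ n = A * q.
    by rewrite /e /Y /A /w emn exprD; field; nz.
  have := cleared_sears q_neq0 (b * w) (q / (b * w * q ^+ l)) A0 Y0 g0 nzq bal.
  have -> : Y * (b * w) * (q / (b * w * q ^+ l)) = - q.
    by rewrite /Y; field; nz.
  have -> : Y * (q / (b * w * q ^+ l)) = a by rewrite /Y ey; field; nz.
  have -> : Y * (b * w) = q ^+ l.+1 / a by rewrite /Y ey exprS; field; nz.
  have -> : Y * (q / (w * q ^+ l)) = c by rewrite /Y /w; field; nz.
  have -> // : Y * e = q ^+ l.+1 / (q ^+ (m + 2 * n) * c).
  by rewrite /Y /e exprS; field; nz.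
(* Now the pair has product q and -c plays the role of Y u v, so Y = -q/c = w. Dividing by w gives u
   v q = c^2, the condition of [watson], and turns the lower -q into c. *)
pose u i := a * c / (q * q ^+ i); pose v i := q ^+ i * c / a.
have u0 i : u i != 0 by rewrite /u; have := expq_neq0 q_neq0 i => i0; nz.
have v0 i : v i != 0 by rewrite /v; have := expq_neq0 q_neq0 i => i0; nz.
have sears2 i : cleared_phi q n A (b * w * q ^+ i) (q / (b * w * q ^+ i)) (- q) e (q / w) =
    (- q / c) ^+ n * cleared_phi q n A (u i) (v i) c (- c) (q ^+ m / q ^+ (2 * M)).
  have i0 := expq_neq0 q_neq0 i; have mn0 := expq_neq0 q_neq0 m.
  have bal : q ^+ m / q ^+ (2 * M) * c * w * q ^+ n = A * q.
    have eMmn : q ^+ M = q ^+ m * q ^+ n by rewrite -exprD.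
    by rewrite /w /A mulnC exprM eMmn; field; nz.
  have := cleared_sears q_neq0 (u i) (v i) A0 w0 hc nzq bal.
  have -> : w * u i * v i = - c by rewrite /w /u /v; field; nz.
  have -> : w * v i = b * w * q ^+ i by rewrite ey /w /v; field; nz.
  have -> : w * u i = q / (b * w * q ^+ i) by rewrite ey /w /u; field; nz.
  have -> : w * c = - q by rewrite /w; field.
  have -> : w * (q ^+ m / q ^+ (2 * M)) = e.
    have -> : q ^+ (2 * M) = q ^+ (m + 2 * n) * q ^+ m.
      by rewrite -exprD; congr (_ ^+ _); rewrite /M; clear; lia.
    by rewrite /w /e; field; nz.
  by move=> E; rewrite [LHS]cleared_phi_rot eqw E (cleared_phi_rot _ _ _ _ _ (- c)).
have nzbw2 : P (b * w ^+ 2) l != 0 by rewrite ebw2.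
have nzwl : P (q / (w * q ^+ l)) n != 0 by rewrite eqwl.
have linear := phi_linearization q_neq0 A (- q) e b0 w0 nzql nzy2 nzbw2 nzy nzwl.
pose R := P (c * q ^+ n) m * P (- (c * q ^+ n)) m
  * (P (q ^- (2 * M)) m * qsign M / qsign n).
have nz_cn x : P x M != 0 -> P x n != 0 /\ P (x * q ^+ n) m != 0.
  by rewrite /M addnC qpochD mulf_eq0 negb_or => /andP[].
have [_ nzcn] := nz_cn c nzcM.
have [nzNcn nzNcnm] := nz_cn (- c) nzNcM; rewrite mulNr in nzNcnm.
have qsn := qsign_neq0 q_neq0 n.
have R0 : R != 0.
  have := @qpoch_expVq_neq0 _ _ q_neq0 (2 * M) m _ nz2M.
  move=> /(_ _) h; have {}h : P (q ^- (2 * M)) m != 0.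
    by apply: h; rewrite /M; clear; lia.
  by rewrite /R; nz.
pose E i j := vwp (q ^- M) j
     * (P (q ^- m) j / (P q j * P (q ^+ m / q ^+ (2 * M)) j))
     * (P (- q ^- M) j * (P (u i) j * P (v i) j) * (q ^+ m) ^+ j)
     * (P (- q) (M - j) / q ^+ (M - j + (M - j) * (M - j))
        * (qpoch (q * (u i * q ^+ j)) (q ^+ 2) (M - j)
           * qpoch (q * (v i * q ^+ j)) (q ^+ 2) (M - j))).
have sum_E i : \sum_(j < m.+1) E i j =
    R * cleared_phi q n A (u i) (v i) c (- c) (q ^+ m / q ^+ (2 * M)).
  rewrite -(@phi_reduction _ q q_neq0 n m (u i) (v i) c nz2M) -/M.
  apply: eq_bigr => -[j /= lt_jm] _; rewrite ltnS in lt_jm.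
  have le_jM : (M - j <= M)%N by apply: leq_subr.
  have i0 := expq_neq0 q_neq0 i; have j0 := expq_neq0 q_neq0 j.
  rewrite watson //; try by nz.
  - by rewrite /u /v; field; nz.
  - by apply: qpoch_neq0_leq nzqM.
  - by apply: qpoch_neq0_leq nzNM.
pose tv i := vwp (b * w) i * vwp_tail l b w i.
have S1 : cleared_phi q n A (b * w) (q / (b * w * q ^+ l)) (- q) e (q / (w * q ^+ l)) =
    P (b * w ^+ 2) l * P (b * w) l / (P ((b * w) ^+ 2) l * P w l)
    * (P (q / (w * q ^+ l)) n / P (- c) n)
    * \sum_(i < l.+1) \sum_(j < m.+1) tv i * ((- q / c) ^+ n / R * E i j).
  have nzy2l : P ((b * w) ^+ 2) l != 0 by rewrite ey2.
  transitivity (P (b * w ^+ 2) l * P (b * w) l / (P ((b * w) ^+ 2) l * P w l)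
    / P (- c) n * (P (q / (w * q ^+ l)) n * \sum_(i < l.+1) vwp (b * w) i * vwp_tail l b w i
    * cleared_phi q n A (b * w * q ^+ i) (q / (b * w * q ^+ i)) (- q) e (q / w))).
    by rewrite -linear eqw; field; nz.
  have -> : \sum_(i < l.+1) vwp (b * w) i * vwp_tail l b w i
      * cleared_phi q n A (b * w * q ^+ i) (q / (b * w * q ^+ i)) (- q) e (q / w) =
      \sum_(i < l.+1) \sum_(j < m.+1) tv i * ((- q / c) ^+ n / R * E i j).
    apply: eq_bigr => -[i /= _] _; rewrite -!mulr_sumr sum_E sears2 /tv.
    by field; nz.
  by ring.
rewrite sears1 S1 -ey -ey2 -ebw2 eqwl.
have nzy2l : P ((b * w) ^+ 2) l != 0 by rewrite ey2.
pose C0 := P (b * w ^+ 2) l * P (b * w) l / (P ((b * w) ^+ 2) l * P w l)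
    * (P (- q ^- l * c) n / P (- q) n).
transitivity (C0 * \sum_(i < l.+1) \sum_(j < m.+1)
    (Y ^+ n / (qsign n * (P (q ^+ l.+1 / (q ^+ (m + 2 * n) * c)) n * P c n * P (- c) n)))
    * (tv i * ((- q / c) ^+ n / R * E i j))).
  rewrite [in RHS](eq_bigr (fun i : 'I_l.+1 => Y ^+ n
    / (qsign n * (P (q ^+ l.+1 / (q ^+ (m + 2 * n) * c)) n * P c n * P (- c) n))
    * \sum_(j < m.+1) tv i * ((- q / c) ^+ n / R * E i j))).
    by rewrite -[in RHS]mulr_sumr /C0; field; nz.
  by move=> i _; rewrite mulr_sumr.
transitivity (C0 * \sum_(i < l.+1) \sum_(j < m.+1)
    P (q ^+ M.+1) n / P (q ^+ M / q ^+ l * c) n * Tterm q a c l m n i j); last first.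
  rewrite [in LHS](eq_bigr (fun i : 'I_l.+1 => P (q ^+ M.+1) n / P (q ^+ M / q ^+ l * c) n
     * \sum_(j < m.+1) Tterm q a c l m n i j)); last first.
    by move=> i _; rewrite mulr_sumr.
  by rewrite -[in LHS]mulr_sumr /C0 -addnA add1n -/M -/w; field; nz.
congr (_ * _); apply: eq_bigr => -[i /= _] _; apply: eq_bigr => -[j /= lt_jm] _.
rewrite ltnS in lt_jm.
have nzj : P (q ^+ j / q ^+ (2 * M).+1) j != 0.
  have := hT2 _ lt_jm; rewrite !qpochsE !mulf_eq0 !negb_or => /and5P[_ _ _ _].
  rewrite (@exprz_subn (j%:Z - 2 * m%:Z - 2 * n%:Z - 1) j (2 * M).+1) //.
  by rewrite /M; clear; lia.
have T := @term_scalar _ q q_neq0 c l m n j lt_jm hc nz2M nzNM nzj nzcM nzNcM nzH.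
rewrite TtermE // -/M -/(u i) -/(v i) -/b -/w -/(tv i).
rewrite /= -/M -/R -/Y in T.
set Q := _ * (qpoch (q * (u i * q ^+ j)) (q ^+ 2) (M - j) * _).
transitivity (tv i * (Y ^+ n * (- q / c) ^+ n
  / (qsign n * (P (q ^+ l.+1 / (q ^+ (m + 2 * n) * c)) n * P c n * P (- c) n))
  / R * (vwp (q ^- M) j * (P (q ^- m) j / (P q j * P (q ^+ m / q ^+ (2 * M)) j))
     * (q ^+ m) ^+ j) * (P (- q) (M - j) / q ^+ (M - j + (M - j) * (M - j)))) * Q).
  by rewrite /E /Q; ring.
by rewrite T; ring.
Qed.

End Transformation.

Theorem mainTheorem14 (R : realType) (q a c : R[i]) (l m n : nat)
  (hq : q != 0) (ha : a != 0) (hc : c != 0)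
  (* no zero factor in a denominator of the left-hand side *)
  (hphi : forall k : nat, (k <= n)%N ->
     qpochs [:: q; c; q ^ (1 + l%:Z - m%:Z - 2 * n%:Z) / c; - q] q k != 0)
  (* nor of the prefactor *)
  (hpre1 : qpochs [:: q ^+ 2 / a ^+ 2; - q / c] q l != 0)
  (hpre2 : qpochs [:: q ^ (n%:Z + m%:Z - l%:Z) * c; - q] q n != 0)
  (* nor of the terms of the double sum *)
  (hT0 : 1 - q / a ^+ 2 != 0)
  (hT1 : forall i : nat, (i <= l)%N ->
     qpochs [:: q; q ^+ 2 / (a * c); q ^+ (2 + l) / a ^+ 2] q i != 0)
  (hT2 : forall j : nat, (j <= m)%N ->
     qpochs [:: q; c; - c; q ^ (- m%:Z - 2 * n%:Z);
                q ^ (j%:Z - 2 * m%:Z - 2 * n%:Z - 1)] q j != 0)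
  (hT3 : forall j : nat, (j <= m)%N ->
     qpochs [:: q; q ^+ (2 * j) * c ^+ 2] (q ^+ 2) (m + n - j) != 0) :
  qhyper n
    [:: a; q ^+ (1 + l) / a; q ^ (- n%:Z); - q ^ (- m%:Z - n%:Z)]
    [:: c; q ^ (1 + l%:Z - m%:Z - 2 * n%:Z) / c; - q] q q
  = qpochs [:: q ^+ 2 / (a * c); - q / a] q l
    / qpochs [:: q ^+ 2 / a ^+ 2; - q / c] q l
    * (qpochs [:: q ^+ (1 + m + n); - q ^ (- l%:Z) * c] q n
       / qpochs [:: q ^ (n%:Z + m%:Z - l%:Z) * c; - q] q n)
    * \sum_(i < l.+1) \sum_(j < m.+1) Tterm q a c l m n i j.
Proof. exact: transformation_4phi3. Qed.
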